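(* Let $\mathbb{B}_d = \{ z \in \mathbb{C}^d : \sum_{j=1}^d |z_j|^2 < 1\}$ be the unit ball in $\mathbb{C}^d$, and let $V$ be a relatively polynomially convex subset of $\mathbb{B}_d$ that has the extension property (with respect to $\Omega = \mathbb{B}_d$). Then $V$ is a retract of $\mathbb{B}_d$.
   Context: For an open set $\Omega \subseteq \mathbb{C}^d$, a subset $V \subseteq \Omega$ is relatively polynomially convex if $\overline{V} \cap \Omega = V$ and $\overline{V}$ is polynomially convex in $\mathbb{C}^d$. $H^\infty(\Omega)$ is the algebra of bounded holomorphic functions on $\Omega$ with the sup-norm $\|F\|_\Omega = \sup_\Omega |F|$. For $\Omega$ bounded, $V \subseteq \Omega$ has the extension property if for every polynomial $p$ there exists $F \in H^\infty(\Omega)$ such that $F|_V = p|_V$ and $\|F\|_\Omega = \sup_V |p|$. $V$ is a retract of $\Omega$ if there is a holomorphic map $r : \Omega \to \Omega$ whose range is $V$ and such that $r|_V$ is the identity. *)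

(* Defs.v *)
(* MathComp-Analysis, over the complex numbers R[i] of an arbitrary
   R : realType. *)
From mathcomp Require Import all_boot all_order all_algebra.
From mathcomp Require Import all_classical all_reals all_analysis.
From mathcomp Require Import complex.
From mathcomp Require mpoly.

Set Implicit Arguments.
Unset Strict Implicit.
Unset Printing Implicit Defensive.

Import Order.TTheory GRing.Theory Num.Theory.
Import numFieldNormedType.Exports.

Local Open Scope classical_set_scope.
Local Open Scope ring_scope.

(* R[i] as a bundled numClosedFieldType: this is what gives it, through
   numFieldNormedType.Exports, the topology of the modulus and the structure of
   a normed module over itself; the bare type R[i] carries neither. *)
Definition cplx (R : realType) : numClosedFieldType := R[i].
Arguments cplx : simpl never.

Section SeveralComplexVariables.
Variable R : realType.
Implicit Types d : nat.

(* The library's norm on row vectors is the max norm; it is used here only for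
   the topology and for differentiability. *)
Definition Cn d : normedModType (cplx R) := 'rV[cplx R]_d.

(* `|z| is an element of cplx R (with zero imaginary part); cabs z is the same
   number in R. *)
Definition cabs (z : cplx R) : R := complex.Re `|z|.

Definition peval d (p : mpoly.mpoly d (cplx R)) (z : Cn d) : cplx R :=
  mpoly.meval (fun j => z 0 j) p.

(* differentiable is Frechet differentiability over the scalar field cplx R,
   i.e. the differential is complex linear. *)
Definition holomorphic_on d (W : normedModType (cplx R))
    (Omega : set (Cn d)) (f : Cn d -> W) : Prop :=
  forall z, Omega z -> differentiable f z.

(* The supremum is taken in \bar R: it is -oo on the empty set and +oo for
   functions unbounded on A. *)
Definition supnorm d (A : set (Cn d)) (f : Cn d -> cplx R) : \bar R :=
  ereal_sup [set (cabs (f z))%:E | z in A].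

(* Elements of H^oo(Omega) are represented by total functions whose values
   outside Omega are irrelevant. *)
Definition Hinfty d (Omega : set (Cn d)) (F : Cn d -> cplx R) : Prop :=
  holomorphic_on (W := cplx R) Omega F /\ (supnorm Omega F < +oo)%E.

Definition polynomial_hull d (K : set (Cn d)) : set (Cn d) :=
  [set z | forall p : mpoly.mpoly d (cplx R),
             ((cabs (peval p z))%:E <= supnorm K (peval p))%E].

Definition polynomially_convex d (K : set (Cn d)) : Prop :=
  polynomial_hull K = K.

Definition relatively_polynomially_convex d (Omega V : set (Cn d)) : Prop :=
  closure V `&` Omega = V /\ polynomially_convex (closure V).

Definition extension_property d (Omega V : set (Cn d)) : Prop :=
  forall p : mpoly.mpoly d (cplx R),
    exists F : Cn d -> cplx R,
      [/\ Hinfty Omega F,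
          forall z, V z -> F z = peval p z
        & supnorm Omega F = supnorm V (peval p)].

Definition is_retract d (Omega V : set (Cn d)) : Prop :=
  exists r : Cn d -> Cn d,
    [/\ holomorphic_on Omega r,
        forall z, Omega z -> Omega (r z),
        r @` Omega = V
      & forall z, V z -> r z = z].

Definition unit_ball d : set (Cn d) :=
  [set z | \sum_(j < d) `|z 0 j| ^+ 2 < 1].

End SeveralComplexVariables.

Arguments unit_ball R d : clear implicits.

(* Main.v *)
Require Import Defs.
From mathcomp Require Import all_boot all_order all_algebra.
From mathcomp Require Import all_classical all_reals all_analysis.
From mathcomp Require Import cyclic separable cyclotomic complex ring lra.
From mathcomp Require mpoly.

(* Through two points [disc c u a], [disc c u b] of V passes a complex line, whose trace on the ball is a
   disc with boundary points [disc c u tau].  If such a boundary point were not in the closure of V, the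
   coordinate of the disc, which has modulus less than 1 on the ball and is close to [tau] only near
   [disc c u tau], would stay away from [tau] on V; multiplying the Moebius coordinate vanishing at [a]
   by [bump] would then give a function of modulus at most 1 on V, approximable by polynomials, which
   separates the two points better than the Schwarz-Pick lemma allows for its extension to the ball.
   So the closure of V contains the boundary of the disc, hence by the maximum principle and polynomial
   convexity V contains the disc.  A subset of the ball that contains with any two points the trace of
   the line through them is the trace of an affine subspace, and the latter is the range of
   [z |-> c + (1 - |c|^2) / (1 - <z,c>) * P z], where c is its point closest to 0 and P the orthogonal
   projection on its direction.

   The Schwarz-Pick lemma, for functions that are merely complex differentiable, comes from Goursat's
   bisection argument in polar coordinates: if F 0 = 0 then the means of Re (F z / z) over circles do
   not depend on the radius, so |F' 0| <= 1; with Moebius maps this bounds the derivative everywhere,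
   and integrating along a radius gives the two-point inequality. *)

Set Implicit Arguments.
Unset Strict Implicit.
Unset Printing Implicit Defensive.

Import Order.TTheory GRing.Theory Num.Theory.
Import numFieldNormedType.Exports.

Local Open Scope classical_set_scope.
Local Open Scope ring_scope.

(** * Goursat's theorem for planar forms *)

Require Import Defs.
From mathcomp Require Import all_boot all_order all_algebra.
From mathcomp Require Import all_classical all_reals all_analysis.
From mathcomp Require Import complex ring lra.

Set Implicit Arguments.
Unset Strict Implicit.
Unset Printing Implicit Defensive.

Import Order.TTheory GRing.Theory Num.Theory.
Import numFieldNormedType.Exports.

Local Open Scope classical_set_scope.
Local Open Scope ring_scope.

Section Goursat.
Variable R : realType.
Implicit Types (a b c d x y s t : R) (f g : R -> R) (P Q K : R -> R -> R).

Lemma derive_bounded_increment f g a b M :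
    a <= b -> (forall t, a <= t <= b -> is_derive t 1 f (g t)) ->
    (forall t, a <= t <= b -> `|g t| <= M) ->
  `|f b - f a| <= M * (b - a).
Proof.
move=> ab df gM.
have [| |t] := @MVT_segment R f g a b ab.
- by move=> t; rewrite in_itv /= => /andP[? ?]; apply: df; rewrite !ltW.
- apply: derivable_within_continuous => t; rewrite in_itv /= => tab.
  exact: (@ex_derive _ _ _ _ _ _ _ (df t tab)).
rewrite in_itv /= => tab ->.
by rewrite normrM (ger0_norm (_ : 0 <= b - a)) ?subr_ge0// ler_wpM2r ?subr_ge0// gM.
Qed.

(** The triple [(x, y, s)] stands for the rectangle with lower left corner [(x, y)] and sides
    [s * A], [s * B]. Dependent choice of bad quarters gives nested rectangles, and [(X, Y)] is
    their common point. *)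
Lemma nested_bisection (bad : R -> R -> R -> Prop) (A B x0 y0 : R) :
    0 <= A -> 0 <= B -> bad x0 y0 1 ->
    (forall x y s, 0 < s -> bad x y s -> exists2 x', (x' = x \/ x' = x + s / 2 * A) &
      exists2 y', (y' = y \/ y' = y + s / 2 * B) & bad x' y' (s / 2)) ->
  exists X Y : R, forall e : R, 0 < e -> exists x y s,
    [/\ 0 < s < e, bad x y s, x0 <= x <= X /\ X <= x + s * A <= x0 + A &
        y0 <= y <= Y /\ Y <= y + s * B <= y0 + B].
Proof.
move=> A0 B0 bad0 badS.
have [|u [u0 uS]] := @dependent_choice {p : R * R * R | 0 < p.2 /\ bad p.1.1 p.1.2 p.2}
  (fun p q => [/\ (sval q).2 = (sval p).2 / 2,
     (sval q).1.1 = (sval p).1.1 \/ (sval q).1.1 = (sval p).1.1 + (sval p).2 / 2 * A &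
     (sval q).1.2 = (sval p).1.2 \/ (sval q).1.2 = (sval p).1.2 + (sval p).2 / 2 * B])
  _ (exist _ (x0, y0, 1) (conj ltr01 bad0)).
  move=> [[[x y] s] /= [s0 bs]]; apply: cid.
  have [x' hx [y' hy b']] := badS _ _ _ s0 bs.
  have s2 : 0 < s / 2 by lra.
  by exists (exist _ (x', y', s / 2) (conj s2 b')).
pose xn n := (sval (u n)).1.1; pose yn n := (sval (u n)).1.2.
pose sn n := (sval (u n)).2.
have sn0 n : 0 < sn n by rewrite /sn; case: (u n) => ? [].
have badn n : bad (xn n) (yn n) (sn n) by rewrite /xn /yn /sn; case: (u n) => ? [].
have snE n : sn n = 2^-1 ^+ n.
  elim: n => [|n IH]; first by rewrite /sn u0 expr0.
  by rewrite exprS -IH mulrC; case: (uS n).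
(* In each coordinate the left ends increase, the right ends decrease, and every left end is below
   every right end, so the supremum of the left ends lies in all the intervals. *)
have limit (z : nat -> R) D : 0 <= D ->
    (forall n, z n.+1 = z n \/ z n.+1 = z n + sn n / 2 * D) ->
    exists Z, forall n, z 0%N <= z n <= Z /\ Z <= z n + sn n * D <= z 0%N + D.
  move=> D0 zS.
  have snS n : sn n.+1 = sn n / 2 by case: (uS n).
  have step n : z n <= z n.+1 /\ z n.+1 + sn n.+1 * D <= z n + sn n * D.
    rewrite snS; have := mulr_ge0 (ltW (sn0 n)) D0.
    by case: (zS n) => ->; split; lra.
  have up n m : (n <= m)%N -> z n <= z m /\ z m + sn m * D <= z n + sn n * D.
    move=> /subnK <-; elim: (m - n)%N => [|k [IH1 IH2]]; first by rewrite add0n.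
    by have [h1 h2] := step (k + n)%N; rewrite addSn; split; lra.
  have sD n : 0 <= sn n * D by rewrite mulr_ge0// ltW.
  have cross n m : z n <= z m + sn m * D.
    case: (leqP n m) => [/up[h _]|/ltnW /up[_ h]].
      by have := sD m; lra.
    by have := sD n; lra.
  have bnd m : ubound (range z) (z m + sn m * D) by move=> _ [n _ <-].
  exists (sup (range z)) => n.
  have [h1 h2] := up 0%N n (leq0n n).
  split; apply/andP; split => //.
  - apply: ub_le_sup; last by exists n.
    by exists (z 0%N + sn 0%N * D).
  - apply: ge_sup => //; by exists (z 0%N), 0%N.
  - by move: h2; rewrite (snE 0%N) expr0 mul1r.
have [X hX] := limit xn A A0 (fun n => let: And3 _ h _ := uS n in h).
have [Y hY] := limit yn B B0 (fun n => let: And3 _ _ h := uS n in h).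
have xn0 : xn 0%N = x0 by rewrite /xn u0.
have yn0 : yn 0%N = y0 by rewrite /yn u0.
exists X, Y => e e0.
have [n hn] : exists n, sn n < e.
  have := @cvg_geometric R 1 2^-1; rewrite ger0_norm// => /(_ ltac:(lra)).
  move=> /cvgrPdist_lt /(_ e e0)[n _ /(_ n (leqnn n))] /=.
  rewrite sub0r normrN mul1r => h; exists n; rewrite snE.
  by move: h; rewrite ger0_norm// exprn_ge0.
exists (xn n), (yn n), (sn n); split => //.
- by rewrite sn0 hn.
- by move: (hX n); rewrite xn0.
- by move: (hY n); rewrite yn0.
Qed.

(** The arguments [P] and [Q] are meant to be partial primitives of the coefficients of a form, in
    the first and second variable; this is then the integral of the form along the boundary of the
    rectangle, counterclockwise from the bottom side. *)
Definition circulation P Q a b c d :=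
  (P b c - P a c) + (Q b d - Q b c) - (P b d - P a d) - (Q a d - Q a c).

(* [PI] and [QI] are partial primitives of [P dx + Q dy]; the hypothesis on [K] says that the form
   is exact up to an error of the order of the distance to any given point. *)
Lemma goursat P Q PI QI a b c d : a <= b -> c <= d ->
    (forall x y, a <= x <= b -> c <= y <= d -> is_derive x 1 (PI^~ y) (P x y)) ->
    (forall x y, a <= x <= b -> c <= y <= d -> is_derive y 1 (QI x) (Q x y)) ->
    (forall x0 y0 (e : R), a <= x0 <= b -> c <= y0 <= d -> 0 < e ->
      exists2 r : R, 0 < r & exists K Kx Ky,
      forall x y, a <= x <= b -> c <= y <= d -> `|x - x0| < r -> `|y - y0| < r ->
      [/\ is_derive x 1 (K^~ y) (Kx x y), is_derive y 1 (K x) (Ky x y),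
          `|P x y - Kx x y| <= e * (`|x - x0| + `|y - y0|) &
          `|Q x y - Ky x y| <= e * (`|x - x0| + `|y - y0|)]) ->
  circulation PI QI a b c d = 0.
Proof.
move=> ab cd dP dQ loc; apply/eqP/negPn/negP => ne0.
set A := b - a; set B := d - c.
have AE : A = b - a by [].
have BE : B = d - c by [].
have A0 : 0 <= A by rewrite subr_ge0.
have B0 : 0 <= B by rewrite subr_ge0.
pose Phi x y s := circulation PI QI x (x + s * A) y (y + s * B).
pose k : R := `|circulation PI QI a b c d|.
have k0 : 0 < k by rewrite normr_gt0.
(* A rectangle is bad if its circulation is at least [k] times the square of its scale. The
   circulation is additive over the four quarters, so one of them carries at least a fourth of
   it. *)
have [||X [Y XY]] := @nested_bisection (fun x y s => k * s ^+ 2 <= `|Phi x y s|) A B a c A0 B0.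
- by rewrite /Phi /A /B !mul1r ![_ + (_ - _)]addrC !subrK expr1n mulr1.
- move=> x y s s0 bad.
  set h := s / 2.
  have E : Phi x y s = Phi x y h + Phi (x + h * A) y h + Phi x (y + h * B) h
         + Phi (x + h * A) (y + h * B) h.
    rewrite /Phi.
    rewrite (_ : x + h * A + h * A = x + s * A); last by rewrite /h; lra.
    rewrite (_ : y + h * B + h * B = y + s * B); last by rewrite /h; lra.
    rewrite /circulation; ring.
  have ks : k * s ^+ 2 = 4 * (k * h ^+ 2) by rewrite /h; field.
  have := ler_normD (Phi x y h + Phi (x + h * A) y h + Phi x (y + h * B) h)
    (Phi (x + h * A) (y + h * B) h).
  have := ler_normD (Phi x y h + Phi (x + h * A) y h) (Phi x (y + h * B) h).
  have := ler_normD (Phi x y h) (Phi (x + h * A) y h).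
  rewrite -E => n1 n2 n3.
  have [h1|h1] := lerP (k * h ^+ 2) `|Phi x y h|.
    by exists x; [left|exists y; [left|]].
  have [h2|h2] := lerP (k * h ^+ 2) `|Phi (x + h * A) y h|.
    by exists (x + h * A); [right|exists y; [left|]].
  have [h3|h3] := lerP (k * h ^+ 2) `|Phi x (y + h * B) h|.
    by exists x; [left|exists (y + h * B); [right|]].
  have [h4|h4] := lerP (k * h ^+ 2) `|Phi (x + h * A) (y + h * B) h|.
    by exists (x + h * A); [right|exists (y + h * B); [right|]].
  lra.
have Xab : a <= X <= b.
  by have [x [y [s [_ _ [/andP[? ?] /andP[? ?]] _]]]] := XY 1 ltr01; apply/andP; split; lra.
have Ycd : c <= Y <= d.
  by have [x [y [s [_ _ _ [/andP[? ?] /andP[? ?]]]]]] := XY 1 ltr01; apply/andP; split; lra.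
set S := A + B + 1.
have S0 : 0 < S by rewrite /S; lra.
(* On a rectangle of scale [s] around [(X, Y)] the distance to that point is at most [s * S], and
   the sides add up to less than [2 * (s * S)]. The error of the circulation is thus below
   [4 * e * (s * S) ^+ 2], which this [e] makes equal to [k * s ^+ 2]. *)
pose e : R := k / (4 * S ^+ 2).
have e0 : 0 < e by rewrite divr_gt0// mulr_gt0// exprn_gt0.
have [r r0 [K [Kx [Ky HK]]]] := loc X Y e Xab Ycd e0.
have [|x [y [s [/andP[s0 sr] bad [/andP[ax xX] /andP[Xs sb]] [/andP[cy yY] /andP[Ys sd]]]]]] := XY (r / S).
  by rewrite divr_gt0.
have sS : s * S < r by rewrite -ltr_pdivlMr.
have sA0 : 0 <= s * A by rewrite mulr_ge0// ltW.
have sB0 : 0 <= s * B by rewrite mulr_ge0// ltW.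
have sSE : s * S = s * A + s * B + s by rewrite /S; ring.
have pt t u : x <= t <= x + s * A -> y <= u <= y + s * B ->
  [/\ a <= t <= b, c <= u <= d, `|t - X| < r, `|u - Y| < r &
      e * (`|t - X| + `|u - Y|) <= e * (s * S)].
  move=> /andP[t1 t2] /andP[u1 u2].
  have tX : `|t - X| <= s * A by clear -t1 t2 xX Xs; rewrite ler_norml; apply/andP; split; lra.
  have uY : `|u - Y| <= s * B by clear -u1 u2 yY Ys; rewrite ler_norml; apply/andP; split; lra.
  split.
  - by clear -ax t1 t2 sb AE; apply/andP; split; lra.
  - by clear -cy u1 u2 sd BE; apply/andP; split; lra.
  - by clear -tX sS sSE s0 sB0; lra.
  - by clear -uY sS sSE s0 sA0; lra.
  - by rewrite ler_wpM2l ?(ltW e0)//; clear -tX uY sSE s0; lra.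
(* The circulation of the exact form dK vanishes, so [K] may be subtracted from both primitives; the
   mean value inequality then bounds the contribution of each side. *)
have hor u : y <= u <= y + s * B ->
    `|(PI (x + s * A) u - K (x + s * A) u) - (PI x u - K x u)| <= e * (s * S) * (s * A).
  move=> yu; rewrite -[in leRHS](addrK x (s * A)) (addrC _ x).
  apply: (@derive_bounded_increment (fun t => PI t u - K t u) (fun t => P t u - Kx t u)).
  - lra.
  - move=> t /pt/(_ yu)[ta uc tX uY _].
    have [dK _ _ _] := HK t u ta uc tX uY.
    have dPI := dP t u ta uc.
    exact: is_deriveB.
  - move=> t /pt/(_ yu)[ta uc tX uY le].
    by have [_ _ /le_trans + _] := HK t u ta uc tX uY; apply.
have ver t : x <= t <= x + s * A ->
    `|(QI t (y + s * B) - K t (y + s * B)) - (QI t y - K t y)| <= e * (s * S) * (s * B).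
  move=> xt; rewrite -[in leRHS](addrK y (s * B)) (addrC _ y).
  apply: (@derive_bounded_increment (fun u => QI t u - K t u) (fun u => Q t u - Ky t u)).
  - lra.
  - move=> u /(pt t u xt)[ta uc tX uY _].
    have [_ dK _ _] := HK t u ta uc tX uY.
    have dQI := dQ t u ta uc.
    exact: is_deriveB.
  - move=> u /(pt t u xt)[ta uc tX uY le].
    by have [_ _ _ /le_trans +] := HK t u ta uc tX uY; apply.
have m1 : x <= x <= x + s * A by rewrite lexx lerDl.
have m2 : x <= x + s * A <= x + s * A by rewrite lexx lerDl sA0.
have m3 : y <= y <= y + s * B by rewrite lexx lerDl.
have m4 : y <= y + s * B <= y + s * B by rewrite lexx lerDl sB0.
have := hor _ m3; have := hor _ m4; have := ver _ m1; have := ver _ m2.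
rewrite !ler_norml => /andP[v1 v1'] /andP[v2 v2'] /andP[h1 h1'] /andP[h2 h2'].
have : `|Phi x y s| <= 2 * (e * (s * S) * (s * S - s)).
  have -> : 2 * (e * (s * S) * (s * S - s)) =
    e * (s * S) * (s * A) + e * (s * S) * (s * A) + (e * (s * S) * (s * B) + e * (s * S) * (s * B)).
    by rewrite {2}sSE; ring.
  clear -v1 v1' v2 v2' h1 h1' h2 h2'.
  by rewrite ler_norml /Phi /circulation; apply/andP; split; lra.
have : 2 * (e * (s * S) * (s * S - s)) < k * s ^+ 2.
  have -> : k * s ^+ 2 = 4 * (e * (s * S) * (s * S)).
    rewrite (_ : 4 * _ = e * (4 * S ^+ 2) * s ^+ 2); last by ring.
    by rewrite /e divfK// mulf_neq0// ?pnatr_eq0// expf_neq0// gt_eqF.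
  have q0 : 0 < e * (s * S) := mulr_gt0 e0 (mulr_gt0 s0 S0).
  have := mulr_gt0 q0 s0.
  have := mulr_gt0 q0 (mulr_gt0 s0 S0).
  by rewrite mulrBr; clear -s0; lra.
by move: bad; clear -s0; lra.
Qed.

End Goursat.

(** * Complex numbers and complex derivatives *)

Section ComplexModulus.
Variable R : realType.
Local Notation C := (cplx R).
Local Notation Re := (@complex.Re R).
Local Notation Im := (@complex.Im R).
Implicit Types (z w : C) (e r : R).

Definition cofr (x : R) : C := (x%:C)%C.

Lemma normE z : `|z| = cofr (cabs z).
Proof. by rewrite /cabs normc_def. Qed.

Lemma ler_cofr (x y : R) : (cofr x <= cofr y) = (x <= y).
Proof. exact: lecR. Qed.

Lemma ltr_cofr (x y : R) : (cofr x < cofr y) = (x < y).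
Proof. exact: ltcR. Qed.

Lemma cofrM (x y : R) : cofr (x * y) = cofr x * cofr y.
Proof. exact: (rmorphM (real_complex R)). Qed.

Lemma cofrD (x y : R) : cofr (x + y) = cofr x + cofr y.
Proof. exact: (rmorphD (real_complex R)). Qed.

Lemma cofrB (x y : R) : cofr (x - y) = cofr x - cofr y.
Proof. exact: (rmorphB (real_complex R)). Qed.

Lemma cofrX (x : R) n : cofr (x ^+ n) = cofr x ^+ n.
Proof. exact: (rmorphXn (real_complex R)). Qed.

Lemma cofr1 : cofr 1 = 1. Proof. by []. Qed.

Lemma cofr0 : cofr 0 = 0. Proof. by []. Qed.

Lemma cofrV (x : R) : cofr x^-1 = (cofr x)^-1.
Proof. exact: (fmorphV (real_complex R)). Qed.

Lemma conj_cofr (x : R) : (cofr x)^* = cofr x.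
Proof. by rewrite /cofr; apply: conj_Creal; apply/complex_realP; exists x. Qed.

Lemma cofr_inj : injective cofr.
Proof. exact: complexI. Qed.

Lemma cabs_ge0 z : 0 <= cabs z.
Proof. by rewrite -ler_cofr -normE cofr0 normr_ge0. Qed.

Lemma cabs_sqr z : cabs z ^+ 2 = Re z ^+ 2 + Im z ^+ 2.
Proof.
by rewrite /cabs normc_def /= sqr_sqrtr// addr_ge0// sqr_ge0.
Qed.

Lemma cofr_cabs_sqr z : cofr (cabs z ^+ 2) = z * z^*.
Proof. by rewrite cofrX -normE normCK. Qed.

Lemma cabs_eq0 z : (cabs z == 0) = (z == 0).
Proof. by rewrite -(normr_eq0 z) normE -(inj_eq cofr_inj). Qed.

Lemma cabs0 : cabs (0 : C) = 0.
Proof. by apply/eqP; rewrite cabs_eq0. Qed.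

Lemma cabs1 : cabs (1 : C) = 1.
Proof. by rewrite /cabs normr1. Qed.

Lemma cabs_gt0 z : (0 < cabs z) = (z != 0).
Proof. by rewrite lt_def cabs_eq0 cabs_ge0 andbT. Qed.

Lemma cabsM z w : cabs (z * w) = cabs z * cabs w.
Proof. by apply: cofr_inj; rewrite cofrM -!normE normrM. Qed.

Lemma cabsV z : cabs z^-1 = (cabs z)^-1.
Proof. by apply: cofr_inj; rewrite cofrV -!normE normfV. Qed.

Lemma cabsX z n : cabs (z ^+ n) = cabs z ^+ n.
Proof. by apply: cofr_inj; rewrite cofrX -!normE normrX. Qed.

Lemma cabsN z : cabs (- z) = cabs z.
Proof. by rewrite /cabs normrN. Qed.

Lemma cabs_distC z w : cabs (z - w) = cabs (w - z).
Proof. by rewrite /cabs distrC. Qed.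

Lemma cabs_conj z : cabs z^* = cabs z.
Proof. by rewrite /cabs norm_conjC. Qed.

Lemma cabsD z w : cabs (z + w) <= cabs z + cabs w.
Proof. by rewrite -ler_cofr cofrD -!normE ler_normD. Qed.

Lemma cabsB z w : cabs (z - w) <= cabs z + cabs w.
Proof. by rewrite -(cabsN w) cabsD. Qed.

Lemma cabs_cofr (x : R) : cabs (cofr x) = `|x|.
Proof.
rewrite /cabs normc_def /= expr0n addr0 sqrtr_sqr //.
Qed.

Lemma Re_le_cabs z : `|Re z| <= cabs z.
Proof. by rewrite -ler_sqr ?nnegrE ?cabs_ge0// cabs_sqr real_normK ?num_real// lerDl sqr_ge0. Qed.

Lemma Im_le_cabs z : `|Im z| <= cabs z.
Proof. by rewrite -ler_sqr ?nnegrE ?cabs_ge0// cabs_sqr real_normK ?num_real// lerDr sqr_ge0. Qed.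

Lemma cabs_le_ReIm z : cabs z <= `|Re z| + `|Im z|.
Proof.
rewrite -ler_sqr ?nnegrE ?cabs_ge0 ?addr_ge0// cabs_sqr sqrrD !real_normK ?num_real// -addrA lerD2l lerDr.
by rewrite mulrn_wge0.
Qed.

Lemma ReM z w : Re (z * w) = Re z * Re w - Im z * Im w.
Proof. by case: z w => [a b] [c d]. Qed.

Lemma ImM z w : Im (z * w) = Re z * Im w + Im z * Re w.
Proof. by case: z w => [a b] [c d]. Qed.

Lemma ReB z w : Re (z - w) = Re z - Re w.
Proof. by case: z w => [a b] [c d]. Qed.

Lemma ImB z w : Im (z - w) = Im z - Im w.
Proof. by case: z w => [a b] [c d]. Qed.

Lemma ReD z w : Re (z + w) = Re z + Re w.
Proof. by case: z w => [a b] [c d]. Qed.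

Lemma ImD z w : Im (z + w) = Im z + Im w.
Proof. by case: z w => [a b] [c d]. Qed.

Lemma cplx_gt0 (e : C) : 0 < e -> exists2 r : R, 0 < r & e = cofr r.
Proof.
case: e => a b; rewrite ltcE /= => /andP[/eqP -> a0]; by exists a.
Qed.

Lemma cvg_cabsP T (F : set_system T) (FF : Filter F) (f : T -> C) (l : C) :
  f @ F --> l <-> forall e, 0 < e -> \forall t \near F, cabs (l - f t) < e.
Proof.
rewrite cvgrPdist_lt; split=> H e e0.
- have : 0 < cofr e by rewrite -cofr0 ltr_cofr.
  by move=> /H; apply: filterS => t; rewrite normE ltr_cofr.
- have [r r0 ->] := cplx_gt0 e0.
  by move: (H _ r0); apply: filterS => t; rewrite normE ltr_cofr.
Qed.

Lemma nbhs_cabsP (z : C) (P : set C) :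
  (\forall w \near z, P w) <-> exists2 r : R, 0 < r & forall w, cabs (w - z) < r -> P w.
Proof.
split.
- move=> /nbhs_ballP[e /= /cplx_gt0[r r0 ->] h]; exists r => // w hw; apply: h.
  by rewrite -ball_normE /ball_ /= normE ltr_cofr cabs_distC.
- move=> [r r0 h]; apply/nbhs_ballP; exists (cofr r) => /=.
    by rewrite -cofr0 ltr_cofr.
  move=> w; rewrite -ball_normE /ball_ /= normE ltr_cofr cabs_distC; exact: h.
Qed.

Lemma Re_continuous : continuous (Re : C -> R).
Proof.
move=> z; apply/(@cvgrPdist_lt _ _ _ (nbhs z)) => e e0; apply/nbhs_cabsP; exists e => // w.
by apply: le_lt_trans; rewrite -ReB cabs_distC Re_le_cabs.
Qed.

Lemma Im_continuous : continuous (Im : C -> R).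
Proof.
move=> z; apply/(@cvgrPdist_lt _ _ _ (nbhs z)) => e e0; apply/nbhs_cabsP; exists e => // w.
by apply: le_lt_trans; rewrite -ImB cabs_distC Im_le_cabs.
Qed.

Lemma continuous_Complex (T : topologicalType) (f g : T -> R) (x : T) :
  {for x, continuous f} -> {for x, continuous g} ->
  {for x, continuous (fun t => Complex (f t) (g t) : C)}.
Proof.
move=> /cvgrPdist_lt cf /cvgrPdist_lt cg; apply/cvg_cabsP => e e0.
have e2 : 0 < e / 2 by lra.
near=> t; apply: (le_lt_trans (cabs_le_ReIm _)).
rewrite ReB ImB /=.
have : `|f x - f t| < e / 2 by near: t; exact: cf.
have : `|g x - g t| < e / 2 by near: t; exact: cg.
by lra.
Unshelve. all: by end_near. Qed.

Lemma diff_epsP (V W : normedModType C) (f : V -> W) (x : V) : differentiable f x ->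
  forall e, 0 < e -> \forall h \near (0 : V), `|f (x + h) - f x - 'd f x h| <= cofr e * `|h|.
Proof.
move=> df e e0; have := diff_locally df => /eqaddoP /(_ (cofr e)).
rewrite -{1}cofr0 ltr_cofr => /(_ e0); apply: filterS => h /=.
by rewrite !fctE [h + x]addrC opprD addrA.
Qed.

(** Complex differentiability in terms of the real-valued modulus [cabs], so that all later
    estimates are inequalities in [R]. *)
Lemma is_derive_eps (f : C -> C) z (l : C) : is_derive z 1 f l ->
  forall e, 0 < e -> exists2 r : R, 0 < r &
    forall w, cabs (w - z) < r -> cabs (f w - f z - l * (w - z)) <= e * cabs (w - z).
Proof.
move=> [df dl] e e0.
have dd : differentiable f z by apply/derivable1_diffP.
have /nbhs_cabsP[r r0 H] := diff_epsP dd e0.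
exists r => // w wr; have := H (w - z); rewrite subr0 => /(_ wr).
rewrite (addrC z) subrK !normE -cofrM ler_cofr; congr (cabs (_ - _) <= _).
have -> : 'd f z (w - z) = (w - z) * 'd f z 1.
  by rewrite -[X in 'd _ _ X = _]mulr1 [LHS]linearZ.
by rewrite -deriveE// dl mulrC.
Qed.

Lemma eps_is_derive (f : C -> C) z (l : C) :
  (forall e, 0 < e -> exists2 r : R, 0 < r &
    forall w, cabs (w - z) < r -> cabs (f w - f z - l * (w - z)) <= e * cabs (w - z)) ->
  is_derive z 1 f l.
Proof.
move=> H.
suff cv : h^-1 *: (f (h *: 1 + z) - f z) @[h --> 0^'] --> l.
  by apply: DeriveDef; [apply/cvg_ex; exists l|apply/cvg_lim].
apply/cvg_cabsP => e e0.
have [r r0 Hr] := H (e / 2) ltac:(lra).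
rewrite near_withinE; apply/nbhs_cabsP; exists r => // h; rewrite subr0 => hr h0.
have := Hr (h + z); rewrite addrK => /(_ hr) le.
have -> : l - h^-1 *: (f (h *: 1 + z) - f z) = - (h^-1 * (f (h + z) - f z - l * h)).
  by rewrite /GRing.scale /= mulr1; field.
rewrite cabsN cabsM cabsV mulrC ltr_pdivrMr ?cabs_gt0//.
have : 0 < cabs h by rewrite cabs_gt0.
move=> h0'; apply: (le_lt_trans le); rewrite ltr_pM2r//; lra.
Qed.

Lemma is_derive_comp (f g : C -> C) z (k l : C) : is_derive z 1 g k ->
  is_derive (g z) 1 f l -> is_derive z 1 (f \o g) (l * k).
Proof.
move=> /is_derive_eps dg /is_derive_eps df; apply: eps_is_derive => e e0.
(* The error of [g] is multiplied by [cabs l], and that of [f] by [1 + cabs k], the Lipschitz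
   constant of [g] near [z] once [e1 <= 1]; [M] is the sum of the two factors. *)
pose M := cabs k + cabs l + 1.
have M0 : 0 < M by rewrite /M; have := cabs_ge0 k; have := cabs_ge0 l; lra.
pose e1 := Num.min 1 (e / (2 * M)).
have e10 : 0 < e1 by rewrite lt_min ltr01 divr_gt0// mulr_gt0.
have [r1 r10 H1] := dg e1 e10.
have [r2 r20 H2] := df e1 e10.
exists (Num.min r1 (r2 / (M + 1))).
  by rewrite lt_min r10 divr_gt0// addr_gt0.
move=> w; rewrite lt_min => /andP[/H1 g1 wr2].
set D := cabs (w - z) in g1 wr2 *.
have D0 : 0 <= D by exact: cabs_ge0.
have e1_le1 : e1 <= 1 by rewrite ge_min lexx.
have e1M : e1 * M <= e / 2.
  by rewrite -ler_pdivlMr// (le_trans (_ : _ <= e / (2 * M)))// ?ge_min ?lexx ?orbT// invfM mulrA.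
have gD : cabs (g w - g z) <= (1 + cabs k) * D.
  rewrite -(subrK (k * (w - z)) (g w - g z)).
  apply: (le_trans (cabsD _ _)); rewrite cabsM mulrDl mul1r -/D lerD2r.
  by apply: (le_trans g1); rewrite -[leRHS]mul1r ler_wpM2r.
have gr2 : cabs (g w - g z) < r2.
  apply: (le_lt_trans gD).
  rewrite ltr_pdivlMr in wr2; last by rewrite addr_gt0.
  apply: le_lt_trans wr2; rewrite mulrC ler_wpM2l// /M; have := cabs_ge0 l; lra.
have := H2 _ gr2 => /= f1.
rewrite (_ : f (g w) - f (g z) - l * k * (w - z) =
  (f (g w) - f (g z) - l * (g w - g z)) + l * (g w - g z - k * (w - z))); last by ring.
apply: (le_trans (cabsD _ _)); rewrite cabsM.
have a1 : cabs l * cabs (g w - g z - k * (w - z)) <= e1 * (cabs l * D).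
  by rewrite mulrCA ler_wpM2l ?cabs_ge0.
have a2 : e1 * cabs (g w - g z) <= e1 * ((1 + cabs k) * D) by rewrite ler_wpM2l// ltW.
have a3 : e1 * M * D <= e / 2 * D by rewrite ler_wpM2r.
have a4 : 0 <= e * D by rewrite mulr_ge0// ltW.
have a5 : e1 * M * D = e1 * (cabs l * D) + e1 * ((1 + cabs k) * D) by rewrite /M; ring.
lra.
Qed.

End ComplexModulus.

(** * Means over circles *)

Section CircleMeans.
Variable R : realType.
Local Notation C := (cplx R).
Local Notation Re := (@complex.Re R).
Local Notation Im := (@complex.Im R).
Implicit Types (a b x y r t : R) (z w : C).

Definition prim a (f : R -> R) x : R := parameterized_integral lebesgue_measure a x f.

Lemma is_derive_prim a b x (f : R -> R) : a < x < b ->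
  (forall t, a <= t <= b -> {for t, continuous f}) -> is_derive x 1 (prim a f) (f x).
Proof.
move=> /andP[ax xb] cf.
have ci : {within `[a, b], continuous f}.
  apply: continuous_in_subspaceT => t; rewrite inE /= in_itv /=; exact: cf.
have fi := continuous_compact_integrable (@segment_compact _ a b) ci.
have cx : {for x, continuous f} by apply: cf; rewrite !ltW.
have [df dE] := continuous_FTC1_closed xb fi ax cx.
apply: DeriveDef; first exact: df.
by rewrite -derive1E.
Qed.

Definition cis t : C := Complex (cos t) (sin t).

Definition polar r t : C := cofr r * cis t.

Lemma cabs_cis t : cabs (cis t) = 1.
Proof. by rewrite /cabs normc_def /= cos2Dsin2 sqrtr1. Qed.

Lemma cabs_polar r t : 0 <= r -> cabs (polar r t) = r.
Proof. by move=> r0; rewrite cabsM cabs_cis mulr1 cabs_cofr ger0_norm. Qed.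

Lemma Re_polar r t : Re (polar r t) = r * cos t.
Proof. by rewrite /polar ReM /= mul0r subr0. Qed.

Lemma Im_polar r t : Im (polar r t) = r * sin t.
Proof. by rewrite /polar ImM /= mul0r addr0. Qed.

Lemma ler_dist_cos (s t : R) : `|cos s - cos t| <= `|s - t|.
Proof.
wlog st : s t / t <= s => [H|].
  by have [/H//|/ltW/H] := leP t s; rewrite distrC (distrC t).
rewrite (ger0_norm (_ : 0 <= s - t)) ?subr_ge0// -[leRHS]mul1r.
apply: (@derive_bounded_increment _ cos (fun t => - sin t)) => // u _.
by rewrite normrN ler_norml sin_geN1 sin_le1.
Qed.

Lemma ler_dist_sin (s t : R) : `|sin s - sin t| <= `|s - t|.
Proof.
wlog st : s t / t <= s => [H|].
  by have [/H//|/ltW/H] := leP t s; rewrite distrC (distrC t).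
rewrite (ger0_norm (_ : 0 <= s - t)) ?subr_ge0// -[leRHS]mul1r.
apply: (@derive_bounded_increment _ sin cos) => // u _.
by rewrite ler_norml cos_geN1 cos_le1.
Qed.

Lemma cabs_polar_dist r s t u : 0 <= s <= 1 ->
  cabs (polar r t - polar s u) <= 2 * (`|r - s| + `|t - u|).
Proof.
move=> /andP[s0 s1]; apply: (le_trans (cabs_le_ReIm _)).
rewrite ReB ImB !Re_polar !Im_polar.
have E (f : R -> R) : r * f t - s * f u = (r - s) * f t + s * (f t - f u) by ring.
have cosb : `|(r - s) * cos t| <= `|r - s|.
  by rewrite normrM ler_piMr// ler_norml cos_geN1 cos_le1.
have sinb : `|(r - s) * sin t| <= `|r - s|.
  by rewrite normrM ler_piMr// ler_norml sin_geN1 sin_le1.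
have cosd : `|s * (cos t - cos u)| <= `|t - u|.
  rewrite normrM (ger0_norm s0); apply: le_trans (ler_dist_cos _ _).
  by rewrite ler_piMl.
have sind : `|s * (sin t - sin u)| <= `|t - u|.
  rewrite normrM (ger0_norm s0); apply: le_trans (ler_dist_sin _ _).
  by rewrite ler_piMl.
rewrite !E; have := ler_normD ((r - s) * cos t) (s * (cos t - cos u)).
have := ler_normD ((r - s) * sin t) (s * (sin t - sin u)); lra.
Qed.

(* In polar coordinates, [Im (g dz) = formr g dr + formt g dt]. *)
Definition formr (g : C -> C) r t : R := Im (g (polar r t) * cis t).

Definition formt (g : C -> C) r t : R := r * Re (g (polar r t) * cis t).

(* An affine function has an explicit quadratic primitive, whence [K]. *)
Lemma form_locally_exact (g : C -> C) l r0 t0 e : 0 <= r0 <= 1 ->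
  is_derive (polar r0 t0) 1 g l -> 0 < e ->
  exists2 d : R, 0 < d & exists K Kx Ky : R -> R -> R,
    forall r t, 0 <= r <= 1 -> `|r - r0| < d -> `|t - t0| < d ->
    [/\ is_derive r 1 (K^~ t) (Kx r t), is_derive t 1 (K r) (Ky r t),
        `|formr g r t - Kx r t| <= e * (`|r - r0| + `|t - t0|) &
        `|formt g r t - Ky r t| <= e * (`|r - r0| + `|t - t0|)].
Proof.
move=> r01 /is_derive_eps dg e0.
set z0 := polar r0 t0; set x0 := Re z0; set y0 := Im z0; set g0 := g z0.
have [d d0 Hd] := dg (e / 2) ltac:(lra).
(* By [cabs_polar_dist] two increments below [d / 4] move the point by less than [d]; the same
   factor 2 explains [e / 2] above. The function [K] below is the imaginary part of g0 z + l (z -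
   z0)^2 / 2, a primitive of the affine approximation [h]. *)
exists (d / 4); first by lra.
exists (fun r t => Re g0 * (r * sin t) + Im g0 * (r * cos t) +
   Re l * ((r * cos t - x0) * (r * sin t - y0)) +
   Im l / 2 * ((r * cos t - x0) ^+ 2 - (r * sin t - y0) ^+ 2)).
pose h r t : C := g0 + l * (polar r t - z0).
exists (fun r t => Im (h r t * cis t)), (fun r t => r * Re (h r t * cis t)).
move=> r t /andP[rge0 rle1] hr ht.
have near0 : cabs (polar r t - z0) <= 2 * (`|r - r0| + `|t - t0|).
  exact: cabs_polar_dist.
have err : cabs (g (polar r t) - h r t) <= e * (`|r - r0| + `|t - t0|).
  rewrite /h opprD addrA; apply: le_trans (Hd _ _) _; first by lra.
  by apply: le_trans (ler_wpM2l _ near0) _; lra.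
split.
- apply: is_derive_eq; rewrite /GRing.scale /= /h !(ImM, ReM, ReB, ImB, ReD, ImD, Re_polar, Im_polar) /=.
  by rewrite /x0 /y0 !(Re_polar, Im_polar); field.
- apply: is_derive_eq; rewrite /GRing.scale /= /h !(ImM, ReM, ReB, ImB, ReD, ImD, Re_polar, Im_polar) /=.
  by rewrite /x0 /y0 !(Re_polar, Im_polar); field.
- rewrite /formr -ImB -mulrBl; apply: le_trans (Im_le_cabs _) _.
  by rewrite cabsM cabs_cis mulr1.
- rewrite /formt -mulrBr -ReB -mulrBl normrM (ger0_norm rge0).
  apply: le_trans (ler_piMl _ rle1) _ => //; apply: le_trans (Re_le_cabs _) _.
  by rewrite cabsM cabs_cis mulr1.
Qed.

Lemma formr_continuous (g : C -> C) r t : {for polar r t, continuous g} ->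
  {for r, continuous (fun r => formr g r t)}.
Proof.
move=> cg; apply: (@continuous_comp _ _ _ (fun r => g (polar r t) * cis t) Im); last exact: Im_continuous.
apply: (@continuousM _ _ (fun r => g (polar r t)) (cst (cis t))); last exact: cst_continuous.
apply: (@continuous_comp _ _ _ (polar^~ t) g); last exact: cg.
apply: (@continuousM _ _ (@cofr R) (cst (cis t))); last exact: cst_continuous.
by apply: continuous_Complex; [exact: cvg_id|exact: cst_continuous].
Qed.

Lemma formt_continuous (g : C -> C) r t : {for polar r t, continuous g} ->
  {for t, continuous (formt g r)}.
Proof.
move=> cg.
have cc : {for t, continuous cis}.
  by apply: continuous_Complex; [exact: continuous_cos|exact: continuous_sin].
apply: (@continuousM _ _ (cst r)); first exact: cst_continuous.
apply: (@continuous_comp _ _ _ (fun t => g (polar r t) * cis t) Re); last exact: Re_continuous.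
apply: (@continuousM _ _ (fun t => g (polar r t)) cis); last exact: cc.
apply: (@continuous_comp _ _ _ (polar r) g); last exact: cg.
by apply: (@continuousM _ _ (cst (cofr r)) cis); [exact: cst_continuous|exact: cc].
Qed.

(** The integral of [formt g r] over a full turn. The primitive starts at -1 so that it has a
    two-sided derivative at the end point 0 as well. *)
Definition mean_increment (g : C -> C) r : R :=
  prim (-1) (formt g r) (pi *+ 2) - prim (-1) (formt g r) 0.

Lemma is_derive_formt (g : C -> C) r y : (forall t, {for polar r t, continuous g}) ->
  0 <= y <= pi *+ 2 -> is_derive y 1 (prim (-1) (formt g r)) (formt g r y).
Proof.
move=> cg /andP[y0 y1]; apply: (@is_derive_prim _ (pi *+ 2 + 1)).
  by apply/andP; split; lra.
by move=> t _; exact: formt_continuous.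
Qed.

Lemma mean_increment_bound (g : C -> C) r (m e : R) :
  (forall t, {for polar r t, continuous g}) ->
  (forall t, `|formt g r t - m| <= e) -> `|mean_increment g r - m * (pi *+ 2)| <= e * (pi *+ 2).
Proof.
move=> cg H; have pi2 : 0 <= pi *+ 2 :> R by rewrite mulrn_wge0// pi_ge0.
have := @derive_bounded_increment _ (fun t => prim (-1) (formt g r) t - m * t) (fun t => formt g r t - m)
  0 (pi *+ 2) e pi2 _ (fun t _ => H t).
rewrite mulr0 !subr0 /mean_increment addrAC; apply => t t01.
have dp := is_derive_formt cg t01.
by apply: is_derive_eq; rewrite /GRing.scale /=; ring.
Qed.

(** Goursat's theorem on the rectangle [a, b] x [0, 2 pi] of polar coordinates, which avoids the
    origin. The sides at angles 0 and 2 pi cancel by periodicity, and the two others are the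
    integrals over the circles. *)
Lemma mean_increment_const (g : C -> C) (a b : R) : 0 < a <= b -> b < 1 ->
  (forall z, z != 0 -> cabs z < 1 -> derivable g z 1) ->
  mean_increment g a = mean_increment g b.
Proof.
move=> /andP[a0 ab] b1 dg.
have nz r t : 0 < r -> polar r t != 0 by move=> r0; rewrite -cabs_gt0 cabs_polar// ltW.
have dgp r t : 0 < r -> r < 1 -> derivable g (polar r t) 1.
  by move=> r0 r1; apply: dg; [exact: nz|rewrite cabs_polar// ltW].
have cg r t : 0 < r -> r < 1 -> {for polar r t, continuous g}.
  by move=> r0 r1; apply: differentiable_continuous; apply/derivable1_diffP; exact: dgp.
pose PI r t : R := prim (a / 2) (fun s => formr g s t) r.
pose QI r t : R := prim (-1) (formt g r) t.
have pi2 : 0 <= pi *+ 2 :> R by rewrite mulrn_wge0// pi_ge0.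
have := @goursat R (formr g) (formt g) PI QI a b 0 (pi *+ 2) ab pi2.
have -> : circulation PI QI a b 0 (pi *+ 2) = mean_increment g b - mean_increment g a.
  rewrite /circulation /PI.
  have -> : (fun s => formr g s (pi *+ 2)) = (fun s => formr g s 0).
    by apply/funext => s; rewrite /formr /polar /cis cos2pi sin2pi cos0 sin0.
  by rewrite /mean_increment /QI; ring.
move=> H; apply/esym/eqP; rewrite -subr_eq0; apply/eqP; apply: H.
- move=> r t /andP[ar rb] _; apply: (@is_derive_prim _ ((1 + b) / 2)).
    by apply/andP; split; lra.
  by move=> s /andP[s1 s2]; apply: formr_continuous; apply: cg; lra.
- by move=> r t /andP[ar rb] t01; apply: is_derive_formt => // u; apply: cg; lra.
- move=> r0 t0 e /andP[ar rb] _ e0.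
  have r01 : 0 <= r0 <= 1 by apply/andP; split; lra.
  have /derivableP dr := dgp r0 t0 ltac:(lra) ltac:(lra).
  have [d d0 [K [Kx [Ky HK]]]] := form_locally_exact r01 dr e0.
  exists d => //; exists K, Kx, Ky => r t /andP[r1 r2] _; apply: HK.
  by apply/andP; split; lra.
Qed.

Lemma schwarz_derive_Re (F : C -> C) (l : C) :
    (forall z, cabs z < 1 -> derivable F z 1) -> (forall z, cabs z < 1 -> cabs (F z) <= 1) ->
    F 0 = 0 -> is_derive (0 : C) 1 F l ->
  Re l <= 1.
Proof.
move=> dF F1 F0 /is_derive_eps dF0.
(* Dividing by the square makes [formt g r] the real part of F z / z, because z = r cis t
   contributes one more factor z. *)
pose g z := F z * z ^- 2.
have dg z : z != 0 -> cabs z < 1 -> derivable g z 1.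
  move=> z0 z1; apply: derivableM; first exact: dF.
  apply: (@derivableV _ _ (fun z : C => z ^+ 2)); last exact: exprn_derivable.
  by rewrite expf_neq0.
have nz r t : 0 < r -> polar r t != 0 by move=> r0; rewrite -cabs_gt0 cabs_polar// ltW.
have cg r t : 0 < r -> r < 1 -> {for polar r t, continuous g}.
  move=> r0 r1; apply: differentiable_continuous; apply/derivable1_diffP; apply: dg; first exact: nz.
  by rewrite cabs_polar// ltW.
have formtE r t : 0 < r -> formt g r t = Re (F (polar r t) / polar r t).
  move=> r0; have -> : formt g r t = Re (cofr r * (g (polar r t) * cis t)).
    by rewrite [RHS]ReM /= mul0r subr0.
  congr (Re _); have := nz r t r0; rewrite /g; set p := polar r t => p0.
  rewrite (_ : cofr r * _ = F p / p ^+ 2 * (cofr r * cis t)); last by ring.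
  by rewrite -/(polar r t) -/p; field.
have pi2 : 0 < pi *+ 2 :> R by rewrite mulrn_wgt0// pi_gt0.
apply/ler_addgt0Pl => e e0.
have [d d0 Hd] := dF0 (e / 2) ltac:(lra).
(* Two circles are compared: on the one of radius [b], close to 1, the modulus of F z / z is at most
   [b^-1 <= 1 + e / 2]; on the one of radius [a < d] it is within [e / 2] of [l]. *)
pose b := Num.max (1 / 2) (1 / (1 + e / 2)).
have b0 : 0 < b by rewrite lt_max; apply/orP; left; lra.
have b1 : b < 1 by rewrite gt_max; apply/andP; split; rewrite ?ltr_pdivrMr; lra.
have bV : b^-1 <= 1 + e / 2.
  rewrite -[leRHS]invrK lef_pV2 ?posrE ?invr_gt0//; last by lra.
  by rewrite /b le_max !div1r lexx orbT.
pose a := Num.min (d / 2) (b / 2).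
have a0 : 0 < a by rewrite lt_min; apply/andP; split; lra.
have ab : a <= b by rewrite ge_min; apply/orP; right; lra.
have ad : a < d by rewrite gt_min; apply/orP; left; lra.
have Ha : `|mean_increment g a - Re l * (pi *+ 2)| <= e / 2 * (pi *+ 2).
  apply: mean_increment_bound => t; first by apply: cg; lra.
  rewrite formtE// -ReB; apply: le_trans (Re_le_cabs _) _.
  have p0 := nz a t a0; set p := polar a t in p0 *.
  have pa : cabs p = a by rewrite cabs_polar// ltW.
  have := Hd p; rewrite subr0 F0 subr0 pa => /(_ ad) le.
  rewrite (_ : F p / p - l = (F p - l * p) * p^-1); last by field.
  by rewrite cabsM cabsV pa ler_pdivrMr.
have Hb : `|mean_increment g b - 0 * (pi *+ 2)| <= b^-1 * (pi *+ 2).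
  apply: mean_increment_bound => t; first by apply: cg; lra.
  rewrite formtE// subr0; apply: le_trans (Re_le_cabs _) _.
  by rewrite cabsM cabsV (cabs_polar _ (ltW b0)) ler_piMl ?invr_ge0 ?(ltW b0)// F1// (cabs_polar _ (ltW b0)).
have E : mean_increment g a = mean_increment g b by apply: mean_increment_const => //; rewrite a0.
move: Ha Hb; rewrite E mul0r subr0 !ler_norml => /andP[h1 _] /andP[_ h2].
rewrite -(ler_pM2r pi2).
have : b^-1 * (pi *+ 2) <= (1 + e / 2) * (pi *+ 2) by rewrite ler_pM2r.
by move: h1 h2; clear -e0; lra.
Qed.

(** Multiplying [F] by the unimodular [u] with [u * l] real and nonnegative reduces the modulus to
    the real part. *)
Lemma schwarz_derive (F : C -> C) (l : C) :
    (forall z, cabs z < 1 -> derivable F z 1) -> (forall z, cabs z < 1 -> cabs (F z) <= 1) ->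
    F 0 = 0 -> is_derive (0 : C) 1 F l ->
  cabs l <= 1.
Proof.
move=> dF F1 F0 dl; have [->|l0] := eqVneq l 0; first by rewrite cabs0.
pose u : C := l^* / cofr (cabs l).
have ul : u * l = cofr (cabs l).
  have c0 : cofr (cabs l) != 0 by rewrite -normE normr_eq0.
  by apply: (mulIf c0); rewrite /u mulrAC divfK// -expr2 -cofrX cofr_cabs_sqr mulrC.
have u1 : cabs u = 1.
  rewrite cabsM cabsV cabs_conj cabs_cofr (ger0_norm (cabs_ge0 _)) divff//.
  by rewrite cabs_eq0.
have -> : cabs l = Re (u * l) by rewrite ul.
have duF : is_derive (0 : C) 1 (fun z => u * F z) (u * l).
  by apply: is_derive_eq.
apply: (schwarz_derive_Re _ _ _ duF) => [z z1|z z1|].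
- by apply: derivableM; [exact: derivable_cst|exact: dF].
- by rewrite cabsM u1 mul1r F1.
- by rewrite F0 mulr0.
Qed.

End CircleMeans.

(** * The Schwarz-Pick lemma *)

Section SchwarzPick.
Variable R : realType.
Local Notation C := (cplx R).
Local Notation Re := (@complex.Re R).
Implicit Types (z w l : C) (t e : R).

Definition mobius (a z : C) : C := (z + a) / (1 + a^* * z).

Lemma mobius_den_neq0 (a z : C) : cabs a < 1 -> cabs z <= 1 -> 1 + a^* * z != 0.
Proof.
move=> a1 z1; apply/negP => /eqP E.
have : cabs (a^* * z) = 1 by rewrite -cabsN -[RHS](@cabs1 R); congr cabs; rewrite -[RHS](subr0) -E; ring.
rewrite cabsM cabs_conj => h.
have := ler_wpM2l (cabs_ge0 a) z1; lra.
Qed.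

(** Besides showing that [mobius a] preserves the disc, this identity measures how far inside the
    disc the value lies, which the estimate of [exists_bump] relies on. *)
Lemma mobius_sqr (a z : C) : cabs a < 1 -> cabs z <= 1 ->
  (1 - cabs (mobius a z) ^+ 2) * cabs (1 + a^* * z) ^+ 2 = (1 - cabs a ^+ 2) * (1 - cabs z ^+ 2).
Proof.
move=> a1 z1; have d0 := mobius_den_neq0 a1 z1.
rewrite mulrBl mul1r -exprMn -cabsM /mobius divfK//.
apply: (@cofr_inj R); rewrite [in RHS]cofrM !cofrB !cofr_cabs_sqr cofr1.
rewrite !(rmorphD, rmorphM) /= conjCK rmorph1.
ring.
Qed.

Lemma mobius_le1 (a z : C) : cabs a < 1 -> cabs z <= 1 -> cabs (mobius a z) <= 1.
Proof.
move=> a1 z1; have E := mobius_sqr a1 z1.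
have d0 : 0 < cabs (1 + a^* * z) ^+ 2 by rewrite exprn_gt0// cabs_gt0 mobius_den_neq0.
rewrite -(@expr_le1 _ 2)// ?cabs_ge0// -subr_ge0 -(pmulr_lge0 _ d0) E.
by rewrite mulr_ge0// subr_ge0 expr_le1 ?cabs_ge0// ltW.
Qed.

Lemma mobius_lt1 (a z : C) : cabs a < 1 -> cabs z < 1 -> cabs (mobius a z) < 1.
Proof.
move=> a1 z1; have E := mobius_sqr a1 (ltW z1).
have d0 : 0 < cabs (1 + a^* * z) ^+ 2 by rewrite exprn_gt0// cabs_gt0 mobius_den_neq0 ?ltW.
rewrite -(@expr_lt1 _ 2)// ?cabs_ge0// -subr_gt0 -(pmulr_lgt0 _ d0) E.
by rewrite mulr_gt0// subr_gt0 expr_lt1 ?cabs_ge0// ltW.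
Qed.

Lemma mobius0 (a : C) : mobius a 0 = a.
Proof. by rewrite /mobius add0r mulr0 addr0 divr1. Qed.

Lemma mobiusNx (a : C) : mobius (- a) a = 0.
Proof. by rewrite /mobius subrr mul0r. Qed.

Lemma mobiusNK (a z : C) : cabs a < 1 -> cabs z < 1 -> mobius a (mobius (- a) z) = z.
Proof.
move=> a1 z1.
have d1 : 1 + (- a)^* * z != 0 by rewrite mobius_den_neq0 ?cabsN ?ltW.
have d2 : 1 + a^* * mobius (- a) z != 0.
  by rewrite mobius_den_neq0// ltW// mobius_lt1 ?cabsN.
have d3 : 1 + a^* * (- a) != 0 by rewrite mobius_den_neq0// cabsN ltW.
move: d1 d2; rewrite /mobius rmorphN /= => d1 d2.
have E : 1 + a^* * ((z - a) / (1 + - a^* * z)) = (1 + a^* * (- a)) / (1 + - a^* * z).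
  by field.
have E2 : (z - a) / (1 + - a^* * z) + a = z * (1 + a^* * (- a)) / (1 + - a^* * z).
  by field.
rewrite E E2; field.
by apply/andP; split.
Qed.

Lemma is_derive_mobius (a z : C) : 1 + a^* * z != 0 ->
  is_derive z 1 (mobius a) ((1 - a^* * a) / (1 + a^* * z) ^+ 2).
Proof.
move=> d0.
have dn : is_derive z 1 (fun z : C => z + a) 1.
  by apply: is_derive_eq; rewrite addr0.
have dd : is_derive z 1 (fun z : C => 1 + a^* * z) a^*.
  by apply: is_derive_eq; rewrite add0r /GRing.scale /= mulr1.
have dv : is_derive z 1 (fun z : C => (1 + a^* * z)^-1) (- (a^* / (1 + a^* * z) ^+ 2)).
  apply: DeriveDef; first exact: (@derivableV _ _ (fun z : C => 1 + a^* * z)).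
  rewrite (@deriveV _ _ (fun z : C => 1 + a^* * z))// derive_val /GRing.scale /=.
  by rewrite mulNr mulrC.
have := @is_deriveM _ _ (fun z : C => z + a) (fun z : C => (1 + a^* * z)^-1) z 1 _ _ dn dv.
move=> dm; apply: is_derive_eq; rewrite /GRing.scale /=; field.
done.
Qed.

(** Moebius maps on both sides bring [z] and [F z] to 0, where [schwarz_derive] applies; their
    derivatives contribute the factors 1 - |z|^2 and 1 / (1 - |F z|^2). *)
Lemma schwarz_pick_derive (F : C -> C) (z l : C) :
    (forall w, cabs w < 1 -> derivable F w 1) -> (forall w, cabs w < 1 -> cabs (F w) < 1) ->
    cabs z < 1 -> is_derive z 1 F l ->
  cabs l * (1 - cabs z ^+ 2) <= 1 - cabs (F z) ^+ 2.
Proof.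
move=> dF F1 z1 dl.
pose b := - F z.
have b1 : cabs b < 1 by rewrite cabsN F1.
pose G w := mobius b (F (mobius z w)).
have dmob (a w : C) : cabs a < 1 -> cabs w < 1 -> derivable (mobius a) w 1.
  move=> a1 w1; have := is_derive_mobius (mobius_den_neq0 a1 (ltW w1)).
  by move=> H; exact: ex_derive.
have dcomp (f g : C -> C) (w : C) : derivable g w 1 -> derivable f (g w) 1 -> derivable (f \o g) w 1.
  by move=> /derivableP dg /derivableP df; have := is_derive_comp dg df => H; exact: ex_derive.
have dG w : cabs w < 1 -> derivable G w 1.
  move=> w1; apply: (dcomp (mobius b) (F \o mobius z)); last first.
    by apply: dmob => //; apply/F1/mobius_lt1.
  by apply: dcomp; [exact: dmob|apply/dF/mobius_lt1].
have G1 w : cabs w < 1 -> cabs (G w) <= 1.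
  by move=> w1; apply/ltW/mobius_lt1 => //; apply/F1/mobius_lt1.
have G0 : G 0 = 0 by rewrite /G mobius0 mobiusNx.
have Fz1 : 0 < 1 - cabs (F z) ^+ 2 by rewrite subr_gt0 expr_lt1 ?cabs_ge0// F1.
have c01 : cabs (0 : C) <= 1 by rewrite cabs0.
have d1 := is_derive_mobius (mobius_den_neq0 z1 c01).
have d2 : is_derive (mobius z 0) 1 F l by rewrite mobius0.
have d12 := is_derive_comp d1 d2.
have d3 : is_derive ((F \o mobius z) 0) 1 (mobius b) ((1 - b^* * b) / (1 + b^* * F z) ^+ 2).
  by rewrite /= mobius0; apply: is_derive_mobius; apply: mobius_den_neq0 => //; exact/ltW/F1.
have := schwarz_derive dG G1 G0 (is_derive_comp d12 d3).
have -> : 1 - b^* * b = cofr (1 - cabs (F z) ^+ 2).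
  by rewrite cofrB cofr_cabs_sqr /b rmorphN /= mulrNN mulrC.
have -> : 1 + b^* * F z = cofr (1 - cabs (F z) ^+ 2).
  by rewrite cofrB cofr_cabs_sqr /b rmorphN /= mulNr mulrC.
rewrite mulr0 addr0 expr1n divr1.
have -> : 1 - z^* * z = cofr (1 - cabs z ^+ 2) by rewrite cofrB cofr_cabs_sqr mulrC.
have z1' : 0 < 1 - cabs z ^+ 2 by rewrite subr_gt0 expr_lt1 ?cabs_ge0.
rewrite !cabsM cabsV cabsX !cabs_cofr (ger0_norm (ltW Fz1)) (ger0_norm (ltW z1')).
set p := 1 - cabs (F z) ^+ 2 in Fz1 *.
rewrite (_ : p / p ^+ 2 = p^-1); last by field; rewrite gt_eqF.
by rewrite mulrC ler_pdivrMr// mul1r.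
Qed.

Lemma is_derive_Re_ray (F : C -> C) (c l : C) t : is_derive (cofr t * c : C) 1 F l ->
  is_derive t 1 (fun s => Re (F (cofr s * c))) (Re (l * c)).
Proof.
move=> /is_derive_eps dF; pose f s := Re (F (cofr s * c)).
suff cv : h^-1 *: (f (h *: 1 + t) - f t) @[h --> 0^'] --> Re (l * c).
  by apply: DeriveDef; [apply/cvg_ex; exists (Re (l * c))|apply/cvg_lim].
apply/cvgrPdist_lt => e e0.
have M0 : 0 < cabs c + 1 by have := cabs_ge0 c; lra.
have [r r0 Hr] := dF (e / (2 * (cabs c + 1))) ltac:(by rewrite divr_gt0 ?mulr_gt0).
rewrite near_withinE; apply/nbhs_ballP; exists (r / (cabs c + 1)) => /=; first by rewrite divr_gt0.
move=> h; rewrite /ball /= sub0r normrN => hr h0.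
have hE : cofr (h + t) * c - cofr t * c = cofr h * c by rewrite cofrD; ring.
have hc : cabs (cofr (h + t) * c - cofr t * c) = `|h| * cabs c by rewrite hE cabsM cabs_cofr.
have := Hr (cofr (h + t) * c); rewrite hc.
have hr' : `|h| * cabs c < r.
  rewrite ltr_pdivlMr// in hr; apply: le_lt_trans hr; rewrite ler_wpM2l//; lra.
move=> /(_ hr') le.
have -> : Re (l * c) - h^-1 *: (f (h *: 1 + t) - f t) =
   - (h^-1 * Re (F (cofr (h + t) * c) - F (cofr t * c) - l * (cofr h * c))).
  have hl : Re (l * (cofr h * c)) = h * Re (l * c).
    by rewrite mulrCA (ReM (cofr h)) /= mul0r subr0.
  rewrite /GRing.scale /= mulr1 !ReB hl /f; field.
  exact: h0.
rewrite normrN normrM normfV mulrC ltr_pdivrMr ?normr_gt0//.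
rewrite hE in le.
apply: (le_lt_trans (Re_le_cabs _)); apply: (le_lt_trans le).
have h0' : 0 < `|h| by rewrite normr_gt0.
rewrite mulrCA mulrC ltr_pM2r// mulrAC ltr_pdivrMr ?mulr_gt0//.
have := cabs_ge0 c; nra.
Qed.

(** After a rotation making the value at [c] real and nonnegative, the real part [x t] along the
    segment from 0 to [c] satisfies the differential inequality x' (1 - (t k)^2) <= k (1 - x^2), for
    which [t * k] gives equality. The quotient [psi] compares the two: it vanishes at 0 and the mean
    value theorem makes it nonpositive at 1. *)
Lemma schwarz (F : C -> C) (c : C) :
    (forall w, cabs w < 1 -> derivable F w 1) -> (forall w, cabs w < 1 -> cabs (F w) < 1) ->
    F 0 = 0 -> cabs c < 1 ->
  cabs (F c) <= cabs c.
Proof.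
move=> dF F1 F0 c1; have [->|Fc0] := eqVneq (F c) 0; first by rewrite cabs0 cabs_ge0.
pose u : C := (F c)^* / cofr (cabs (F c)).
have n0 : cofr (cabs (F c)) != 0 by rewrite -normE normr_eq0.
have uF : u * F c = cofr (cabs (F c)).
  by apply: (mulIf n0); rewrite /u mulrAC divfK// -expr2 -cofrX cofr_cabs_sqr mulrC.
have u1 : cabs u = 1.
  by rewrite cabsM cabsV cabs_conj cabs_cofr (ger0_norm (cabs_ge0 _)) divff// cabs_eq0.
pose G w := u * F w.
have G1 w : cabs w < 1 -> cabs (G w) < 1 by move=> /F1; rewrite cabsM u1 mul1r.
have dG w : cabs w < 1 -> derivable G w 1.
  by move=> w1; apply: derivableM; [exact: derivable_cst|exact: dF].
set k := cabs c in c1 *.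
have k0 : 0 <= k by exact: cabs_ge0.
pose x t := Re (G (cofr t * c)).
pose x' t := Re (('D_1 G (cofr t * c)) * c).
have path t : 0 <= t <= 1 -> cabs (cofr t * c) = t * k /\ t * k < 1.
  move=> /andP[t0 t1]; rewrite cabsM cabs_cofr ger0_norm//; split=> //.
  by apply: le_lt_trans c1; rewrite ler_piMl.
have xlt t : 0 <= t <= 1 -> `|x t| <= cabs (G (cofr t * c)) < 1.
  by move=> /path[E lt]; rewrite Re_le_cabs G1// E.
have dx t : 0 <= t <= 1 -> is_derive t 1 x (x' t).
  by move=> /path[E lt]; apply/is_derive_Re_ray/derivableP/dG; rewrite E.
have x'le t : 0 <= t <= 1 -> x' t * (1 - (t * k) ^+ 2) <= k * (1 - x t ^+ 2).
  move=> t01; have [E lt] := path t t01.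
  have dGt := dG (cofr t * c); rewrite E in dGt.
  have := @schwarz_pick_derive G (cofr t * c) _ dG G1 _ (derivableP (dGt lt)).
  rewrite E => /(_ lt) le.
  have /andP[xG _] := xlt t t01.
  have xG2 : x t ^+ 2 <= cabs (G (cofr t * c)) ^+ 2.
    by rewrite -real_normK ?num_real// ler_sqr ?nnegrE ?cabs_ge0.
  have p0 : 0 <= 1 - (t * k) ^+ 2.
    have tk0 : 0 <= t * k by case/andP: t01 => ? ?; rewrite mulr_ge0.
    by rewrite subr_ge0 expr_le1// ltW.
  apply: (@le_trans _ _ (k * (cabs ('D_1 G (cofr t * c)) * (1 - (t * k) ^+ 2)))).
    rewrite mulrA ler_wpM2r//; apply: (le_trans (ler_norm _)).
    by apply: (le_trans (Re_le_cabs _)); rewrite cabsM mulrC.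
  by rewrite ler_wpM2l//; lra.
(* The derivative of psi is nonpositive by Schwarz-Pick at the points of the ray. *)
pose psi t := (x t - t * k) / (1 - x t * (t * k)).
have den t : 0 <= t <= 1 -> 0 < 1 - x t * (t * k).
  move=> t01; have [_ lt] := path t t01; have /andP[xG G1t] := xlt t t01.
  have tk0 : 0 <= t * k by case/andP: t01 => ? ?; rewrite mulr_ge0.
  move: (le_lt_trans xG G1t); rewrite ltr_norml => /andP[_ x1]; nra.
pose psi' t := (x' t * (1 - (t * k) ^+ 2) - k * (1 - x t ^+ 2)) / (1 - x t * (t * k)) ^+ 2.
have dpsi t : 0 <= t <= 1 -> is_derive t 1 psi (psi' t).
  move=> t01; have d0 := den t t01; have dxt := dx t t01.
  have dk : is_derive t 1 (fun t : R => t * k) k.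
    by apply: is_derive_eq; rewrite /GRing.scale /=; ring.
  have dn : is_derive t 1 (fun t => x t - t * k) (x' t - k) by exact: is_deriveB.
  have dd : is_derive t 1 (fun t => 1 - x t * (t * k)) (- (x' t * (t * k) + x t * k)).
    by apply: is_derive_eq; rewrite /GRing.scale /=; ring.
  have dv : is_derive t 1 (fun t => (1 - x t * (t * k))^-1)
      (((x' t * (t * k) + x t * k)) / (1 - x t * (t * k)) ^+ 2).
    have d0' : 1 - x t * (t * k) != 0 by rewrite gt_eqF.
    apply: DeriveDef; first exact: (@derivableV _ _ (fun t => 1 - x t * (t * k))).
    rewrite (@deriveV _ _ (fun t => 1 - x t * (t * k)))// derive_val /GRing.scale /=.
    by rewrite mulrN mulNr opprK mulrC.
  have := is_deriveM dn dv; move=> dm; apply: is_derive_eq.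
  by rewrite /GRing.scale /= /psi'; field; rewrite gt_eqF.
have [||s s01 E] := @MVT_segment R psi psi' 0 1 ler01.
- by move=> t; rewrite in_itv /= => /andP[? ?]; apply: dpsi; rewrite !ltW.
- apply: derivable_within_continuous => t; rewrite in_itv /= => t01.
  exact: (@ex_derive _ _ _ _ _ _ _ (dpsi t t01)).
have le : psi' s <= 0.
  rewrite in_itv /= in s01; rewrite /psi' pmulr_lle0 ?invr_gt0 ?exprn_gt0 ?den//.
  by rewrite subr_le0 x'le.
have psi0 : psi 0 = 0.
  by rewrite /psi mul0r subr0 mulr0 subr0 divr1 /x cofr0 mul0r /G F0 mulr0.
have x1 : x 1 = cabs (F c) by rewrite /x cofr1 mul1r /G uF.
have := den 1; rewrite lexx ler01 => /(_ isT) d1.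
move: E; rewrite psi0 !subr0 mulr1 => E.
have : psi 1 <= 0 by rewrite E.
rewrite /psi pmulr_lle0 ?invr_gt0// mul1r subr_le0 x1; exact.
Qed.

(** Precomposition with [mobius a] moves the zero of [F] to the origin. *)
Lemma schwarz_pick (F : C -> C) (a c : C) :
    (forall w, cabs w < 1 -> derivable F w 1) -> (forall w, cabs w < 1 -> cabs (F w) < 1) ->
    cabs a < 1 -> cabs c < 1 -> F a = 0 ->
  cabs (F c) <= cabs (mobius (- a) c).
Proof.
move=> dF F1 a1 c1 Fa.
have g1 : cabs (mobius (- a) c) < 1 by apply: mobius_lt1 => //; rewrite cabsN.
have dFa w : cabs w < 1 -> derivable (F \o mobius a) w 1.
  move=> w1; have /derivableP d2 := dF _ (mobius_lt1 a1 w1).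
  have H := is_derive_comp (is_derive_mobius (mobius_den_neq0 a1 (ltW w1))) d2.
  exact: ex_derive.
have Fa1 w : cabs w < 1 -> cabs ((F \o mobius a) w) < 1.
  by move=> w1; apply/F1/mobius_lt1.
have Fa0 : (F \o mobius a) 0 = 0 by rewrite /= mobius0.
by have := schwarz dFa Fa1 Fa0 g1; rewrite /= mobiusNK.
Qed.

End SchwarzPick.

(** * The perturbed Moebius function *)

Section PlanarExtremal.
Variable R : realType.
Local Notation C := (cplx R).
Local Notation Re := (@complex.Re R).
Implicit Types (z w l a b tau : C) (t e : R).

Lemma cabsD_sqr z w : cabs (z + w) ^+ 2 = cabs z ^+ 2 + 2 * Re (z^* * w) + cabs w ^+ 2.
Proof. case: z w => [x y] [u v]; rewrite !cabs_sqr /=; ring. Qed.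

Lemma Re_cayley z w : z - w != 0 ->
  Re ((z + w) / (z - w)) = (cabs z ^+ 2 - cabs w ^+ 2) / cabs (z - w) ^+ 2.
Proof.
move=> h; have h' : cofr (cabs (z - w) ^+ 2) != 0 by rewrite cofr_cabs_sqr mulf_neq0// conjC_eq0.
have E : (z + w) / (z - w) = (z + w) * (z - w)^* / cofr (cabs (z - w) ^+ 2).
  by rewrite cofr_cabs_sqr invfM mulrACA divff ?conjC_eq0// mulr1.
rewrite E -cofrV mulrC ReM /= mul0r subr0 mulrC; congr (_ / _).
by clear; case: z w => [x y] [u v]; rewrite !cabs_sqr /=; ring.
Qed.

(* For T = (1 + h) tau the real part of (T + z) / (T - z) is, up to the dilation, the Poisson kernel: it
   is of order h on the part of the unit circle away from [tau] and bounded below at a given interior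
   point; [k] is chosen between these two values. *)
Definition bump tau (h e k : R) z : C :=
  1 + cofr e * ((cofr (1 + h) * tau + z) / (cofr (1 + h) * tau - z) - cofr k).

(** Put s = 1 - |z|^2. Away from [tau] the bump satisfies |bump|^2 <= 1 + 2 e s / d^2, and this
    excess is absorbed by the Moebius factor, whose squared modulus is at most 1 - (1 - |a|^2) s /
    4. At [b] the real part of the bump exceeds 1. *)
Lemma exists_bump a b tau (d : R) : cabs a < 1 -> cabs b < 1 -> a != b -> cabs tau = 1 -> 0 < d ->
  exists h e k : R, [/\ 0 < h,
    forall z, cabs z <= 1 -> d <= cabs (z - tau) -> cabs (mobius (- a) z * bump tau h e k z) <= 1 &
    cabs (mobius (- a) b) < cabs (mobius (- a) b * bump tau h e k b)].
Proof.
move=> a1 b1 ab tau1 d0.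
have sqb : 0 < 1 - cabs b ^+ 2 by rewrite subr_gt0 expr_lt1 ?cabs_ge0.
have sqa : 0 < 1 - cabs a ^+ 2 by rewrite subr_gt0 expr_lt1 ?cabs_ge0.
have d20 : 0 < d ^+ 2 by rewrite exprn_gt0.
(* Since |T - b| < 3, the kernel at [b] is larger than (1 - |b|^2) / 9, which is [2 * k]. *)
pose k : R := (1 - cabs b ^+ 2) / 18.
have k0 : 0 < k by rewrite /k; lra.
(* With [h <= 1], the part (2 h + h^2) / d^2 of the kernel caused by the dilation is at most
   [k / 2]. *)
pose h : R := Num.min 1 (k * d ^+ 2 / 6).
have h0 : 0 < h by rewrite lt_min ltr01 /= divr_gt0// mulr_gt0.
have h1 : h <= 1 by rewrite ge_min lexx.
have hk : 3 * h <= k / 2 * d ^+ 2.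
  have : h <= k * d ^+ 2 / 6 by rewrite ge_min lexx orbT.
  lra.
pose M : R := 3 / d + k.
have M0 : 0 < M by rewrite addr_gt0// divr_gt0.
(* The first bound makes the quadratic term [e ^+ 2 * cabs (Y z) ^+ 2] at most [e * k], which the
   linear term compensates; the second one lets the Moebius factor absorb the remaining excess. [M]
   bounds [Y] at distance at least [d] from [tau]. *)
pose e : R := Num.min (k / M ^+ 2) ((1 - cabs a ^+ 2) / 8 * d ^+ 2).
have e0 : 0 < e.
  by rewrite lt_min; apply/andP; split; [rewrite divr_gt0 ?exprn_gt0|rewrite mulr_gt0 ?divr_gt0].
have eM : e * M ^+ 2 <= k by rewrite -ler_pdivlMr ?exprn_gt0// ge_min lexx.
have ed : e <= (1 - cabs a ^+ 2) / 8 * d ^+ 2 by rewrite ge_min lexx orbT.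
pose tau' : C := cofr (1 + h) * tau.
have tau'1 : cabs tau' = 1 + h by rewrite cabsM cabs_cofr tau1 mulr1 ger0_norm//; lra.
have nz z : cabs z <= 1 -> tau' - z != 0.
  move=> z1; rewrite subr_eq0; apply/eqP => E; move: tau'1 z1; rewrite E; lra.
pose Y z : C := (tau' + z) / (tau' - z) - cofr k.
have bumpE z : bump tau h e k z = 1 + cofr e * Y z by [].
have ReY z : cabs z <= 1 -> Re (Y z) = ((1 + h) ^+ 2 - cabs z ^+ 2) / cabs (tau' - z) ^+ 2 - k.
  by move=> z1; rewrite ReB /= Re_cayley ?nz// tau'1.
have Rebump z : Re (bump tau h e k z) = 1 + e * Re (Y z).
  by rewrite bumpE ReD ReM /= mul0r subr0.
exists h, e, k; split => //.
- move=> z z1 dz.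
  (* Pushing the pole radially from [tau] to [tau'] does not bring it closer to any point of the
     closed disc. *)
  have far : d <= cabs (tau' - z).
    apply: (le_trans dz); rewrite cabs_distC -ler_sqr ?nnegrE ?cabs_ge0//.
    have -> : tau' - z = (tau - z) + cofr h * tau by rewrite /tau' cofrD cofr1; ring.
    rewrite (cabsD_sqr (tau - z)) -addrA lerDl addr_ge0 ?sqr_ge0//.
    rewrite mulr_ge0// mulrCA ReM /= mul0r subr0 mulr_ge0 ?(ltW h0)//.
    have -> : Re ((tau - z)^* * tau) = cabs tau ^+ 2 - Re (z^* * tau).
      by case: (tau) z {z1 dz} => [x y] [u v]; rewrite cabs_sqr /=; ring.
    rewrite tau1 expr1n subr_ge0; apply: (le_trans (ler_norm _)); apply: (le_trans (Re_le_cabs _)).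
    by rewrite cabsM cabs_conj tau1 mulr1.
  have far0 : 0 < cabs (tau' - z) by exact: lt_le_trans far.
  set s := 1 - cabs z ^+ 2.
  have s0 : 0 <= s by rewrite subr_ge0 expr_le1 ?cabs_ge0.
  have ReYle : Re (Y z) <= s / d ^+ 2 - k / 2.
    rewrite ReY//; have -> : (1 + h) ^+ 2 - cabs z ^+ 2 = s + (2 * h + h ^+ 2) by rewrite /s; ring.
    have hh : 0 <= h ^+ 2 <= h by rewrite sqr_ge0 expr2 /= -[leRHS]mul1r ler_wpM2r// (ltW h0).
    have : (s + (2 * h + h ^+ 2)) / cabs (tau' - z) ^+ 2 <= (s + (2 * h + h ^+ 2)) / d ^+ 2.
      rewrite ler_wpM2l//; first by case/andP: hh => ? ?; lra.
      by rewrite lef_pV2 ?posrE ?exprn_gt0// ler_sqr ?nnegrE ?(ltW d0) ?cabs_ge0.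
    have : (2 * h + h ^+ 2) / d ^+ 2 <= k / 2.
      by rewrite ler_pdivrMr//; case/andP: hh => ? ?; lra.
    by rewrite (mulrDl s) => q1 q2; lra.
  have Yle : cabs (Y z) <= M.
    apply: (le_trans (cabsB _ _)); rewrite cabs_cofr (gtr0_norm k0) lerD2r cabsM cabsV.
    apply: ler_pM; rewrite ?invr_ge0 ?cabs_ge0//.
      by apply: (le_trans (cabsD _ _)); rewrite tau'1; lra.
    by rewrite lef_pV2 ?posrE.
  have Y2 : cabs (Y z) ^+ 2 <= M ^+ 2 by rewrite ler_sqr ?nnegrE ?cabs_ge0 ?(ltW M0).
  have bump2 : cabs (bump tau h e k z) ^+ 2 <= 1 + 2 * e * s / d ^+ 2.
    rewrite bumpE cabsD_sqr cabs1 expr1n rmorph1 mul1r cabsM exprMn cabs_cofr real_normK ?num_real//.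
    rewrite ReM /= mul0r subr0.
    have : e ^+ 2 * cabs (Y z) ^+ 2 <= e * k.
      by rewrite expr2 -mulrA ler_pM2l//; apply: le_trans eM; rewrite ler_pM2l.
    have : e * Re (Y z) <= e * (s / d ^+ 2 - k / 2) by rewrite ler_pM2l.
    have -> : e * (s / d ^+ 2 - k / 2) = e * s / d ^+ 2 - e * k / 2 by ring.
    have -> : 2 * e * s / d ^+ 2 = 2 * (e * s / d ^+ 2) by ring.
    lra.
  have mob2 : cabs (mobius (- a) z) ^+ 2 <= 1 - (1 - cabs a ^+ 2) / 4 * s.
    have na1 : cabs (- a) < 1 by rewrite cabsN.
    have := mobius_sqr na1 z1; rewrite cabsN -/s.
    set D := cabs (1 + _) => E.
    have D2 : D ^+ 2 <= 4.
      have D0 : 0 <= D by exact: cabs_ge0.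
      have : D <= 2.
        apply: (le_trans (cabsD _ _)); rewrite cabs1 cabsM cabs_conj cabsN.
        have := ler_pM (cabs_ge0 a) (cabs_ge0 z) (ltW a1) z1; lra.
      nra.
    have : 0 <= 1 - cabs (mobius (- a) z) ^+ 2.
      by rewrite subr_ge0 expr_le1 ?cabs_ge0// mobius_le1.
    nra.
  rewrite -(@expr_le1 _ 2)// ?cabs_ge0// cabsM exprMn.
  apply: (le_trans (ler_pM (sqr_ge0 _) (sqr_ge0 _) mob2 bump2)).
  have q : 2 * e * s / d ^+ 2 <= (1 - cabs a ^+ 2) / 4 * s.
    by rewrite ler_pdivrMr//; have := ler_wpM2r s0 ed; lra.
  have p : 0 <= (1 - cabs a ^+ 2) / 4 * s by rewrite mulr_ge0// divr_ge0// (ltW sqa).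
  set A := 2 * e * s / d ^+ 2 in q *; set B := (_ / 4 * s) in q p *.
  have A0 : 0 <= A by rewrite /A divr_ge0 ?(ltW d20)// !mulr_ge0// (ltW e0).
  nra.
- rewrite cabsM ltr_pMr.
    apply: lt_le_trans (Re_le_cabs _); apply: lt_le_trans (ler_norm _); rewrite Rebump ltrDl mulr_gt0//.
    rewrite ReY ?(ltW b1)// subr_gt0 ltr_pdivlMr ?exprn_gt0 ?cabs_gt0 ?nz ?(ltW b1)//.
    have D3 : cabs (tau' - b) < 3 by apply: (le_lt_trans (cabsB _ _)); rewrite tau'1; lra.
    have D0 : 0 <= cabs (tau' - b) by exact: cabs_ge0.
    have D9 : cabs (tau' - b) ^+ 2 <= 9 by nra.
    have : k * cabs (tau' - b) ^+ 2 <= k * 9 by rewrite ler_pM2l.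
    have := sqr_ge0 h; rewrite /k; nra.
  have na1 : cabs (- a) < 1 by rewrite cabsN.
  rewrite cabs_gt0 /mobius; apply: mulf_neq0; first by rewrite subr_eq0 eq_sym.
  by rewrite invr_eq0; exact: mobius_den_neq0 na1 (ltW b1).
Qed.

End PlanarExtremal.

(** * Uniform limits of polynomials *)

Section PolynomialApproximation.
Import (canonicals) mpoly.
Variables (R : realType) (d : nat) (A : set (Cn R d)).
Local Notation C := (cplx R).
Implicit Types (h k : Cn R d -> C).

(** Boundedness is included to make the notion stable under products. *)
Definition poly_approximable h : Prop :=
  (exists M : R, forall z, A z -> cabs (h z) <= M) /\
  forall e : R, 0 < e -> exists p : mpoly.mpoly d C, forall z, A z -> cabs (h z - peval p z) <= e.

Lemma approximable_cst (c : C) : poly_approximable (fun=> c).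
Proof.
split; first by exists (cabs c).
move=> e e0; exists (mpoly.mpolyC d c) => z _.
by rewrite /peval mpoly.mevalC subrr cabs0 ltW.
Qed.

Lemma approximableD h k : poly_approximable h -> poly_approximable k ->
  poly_approximable (fun z => h z + k z).
Proof.
move=> [[M hM] ah] [[N kN] ak]; split.
  by exists (M + N) => z Az; rewrite (le_trans (cabsD _ _))// lerD ?hM ?kN.
move=> e e0; have e2 : 0 < e / 2 by lra.
have [p hp] := ah _ e2; have [q hq] := ak _ e2.
exists (p + q) => z Az; rewrite /peval mpoly.mevalD opprD addrACA.
by apply: (le_trans (cabsD _ _)); have := hp z Az; have := hq z Az; rewrite /peval; lra.
Qed.

Lemma approximableM h k : poly_approximable h -> poly_approximable k ->
  poly_approximable (fun z => h z * k z).
Proof.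
move=> [[M hM] ah] [[N kN] ak].
have bnd z : A z -> cabs (h z) <= `|M| /\ cabs (k z) <= `|N|.
  by move=> Az; rewrite !(le_trans _ (ler_norm _)) ?hM ?kN.
split.
  by exists (`|M| * `|N|) => z /bnd[? ?]; rewrite cabsM ler_pM ?cabs_ge0.
move=> e e0; set S := `|M| + `|N| + 1.
have M0 := normr_ge0 M; have N0 := normr_ge0 N.
have S0 : 0 < S by rewrite /S; lra.
pose e1 : R := Num.min 1 (e / S).
have e10 : 0 < e1 by rewrite lt_min ltr01 divr_gt0.
have e11 : e1 <= 1 by rewrite ge_min lexx.
have e1S : e1 * S <= e by rewrite -ler_pdivlMr// ge_min lexx orbT.
have [p hp] := ah _ e10; have [q hq] := ak _ e10.
exists (p * q) => z Az; rewrite /peval mpoly.mevalM -!/(peval _ z).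
have [bh bk] := bnd z Az; have {hp}ph := hp z Az; have {hq}qk := hq z Az.
have bq : cabs (peval q z) <= `|N| + 1.
  rewrite -(subKr (k z) (peval q z)); apply: (le_trans (cabsB _ _)); lra.
rewrite (_ : h z * k z - _ = h z * (k z - peval q z) + peval q z * (h z - peval p z)); last by ring.
apply: (le_trans (cabsD _ _)); rewrite !cabsM.
have := ler_pM (cabs_ge0 _) (cabs_ge0 _) bh qk.
have := ler_pM (cabs_ge0 _) (cabs_ge0 _) bq ph.
rewrite /S in e1S; lra.
Qed.

Lemma approximable_coord (j : 'I_d) : (exists M : R, forall z, A z -> cabs (z 0 j) <= M) ->
  poly_approximable (fun z => z 0 j).
Proof.
move=> bnd; split => // e e0; exists (mpoly.mpolyX _ (mpoly.mnm1 j)) => z _.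
by rewrite /peval mpoly.mevalXU subrr cabs0 ltW.
Qed.

Lemma approximable_sum (I : Type) (r : seq I) (F : I -> Cn R d -> C) :
  (forall i, poly_approximable (F i)) -> poly_approximable (fun z => \sum_(i <- r) F i z).
Proof.
move=> aF; elim: r => [|i r IH].
  by under eq_fun do rewrite big_nil; exact: approximable_cst.
by under eq_fun do rewrite big_cons; exact: approximableD.
Qed.

(** A partial sum of the geometric series leaves the remainder [h z ^+ n / (1 - h z)], of modulus at
    most q^n / (1 - q). *)
Lemma approximable_geometric h (q : R) : poly_approximable h -> q < 1 ->
  (forall z, A z -> cabs (h z) <= q) -> poly_approximable (fun z => (1 - h z)^-1).
Proof.
move=> ah q1 hq.
(* For empty [A] the number [q] may be negative; a point of [A] forces [0 <= q]. *)
have [[z0 Az0]|A0] := pselect (exists z, A z); last first.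
  split; first by exists 0 => z Az; case: A0; exists z.
  by move=> e _; exists 0 => z Az; case: A0; exists z.
have q0 : 0 <= q := le_trans (cabs_ge0 _) (hq z0 Az0).
have den z : A z -> 1 - q <= cabs (1 - h z).
  move=> Az; have := cabsD (1 - h z) (h z); rewrite subrK cabs1; have := hq z Az; lra.
have nz z : A z -> 1 - h z != 0 by move=> /den h1; rewrite -cabs_gt0; lra.
split.
  exists (1 - q)^-1 => z Az; rewrite cabsV lef_pV2 ?posrE ?cabs_gt0 ?nz ?den ?subr_gt0//.
move=> e e0.
have [n hn] : exists n, q ^+ n <= e / 2 * (1 - q).
  have ee : 0 < e / 2 * (1 - q) by rewrite mulr_gt0 ?subr_gt0// divr_gt0.
  have /cvgrPdist_lt/(_ _ ee)[n _ /(_ n (leqnn n))] :=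
    @cvg_geometric R 1 q ltac:(by rewrite ger0_norm).
  rewrite /= sub0r normrN mul1r => h1; exists n; apply/ltW.
  by move: h1; rewrite ger0_norm// exprn_ge0.
have [_ /(_ (e / 2))[|p hp]] : poly_approximable (fun z => \sum_(i < n) h z ^+ i).
  apply: approximable_sum => i; elim: (i : nat) => [|m IH].
    by under eq_fun do rewrite expr0; exact: approximable_cst.
  by under eq_fun do rewrite exprS; exact: approximableM.
- by rewrite divr_gt0.
exists p => z Az.
have E : (1 - h z)^-1 = \sum_(i < n) h z ^+ i + h z ^+ n / (1 - h z).
  apply: (mulIf (nz z Az)); rewrite mulVf ?nz// mulrDl divfK ?nz//.
  have := subrX1 (h z) n; rewrite -opprB => /(congr1 -%R); rewrite opprK => S.
  by rewrite -[1 - h z]opprB mulrN mulrC -S; ring.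
rewrite E addrAC; apply: (le_trans (cabsD _ _)).
have : cabs (h z ^+ n / (1 - h z)) <= e / 2.
  rewrite cabsM cabsV cabsX ler_pdivrMr ?cabs_gt0 ?nz//.
  apply: (@le_trans _ _ (q ^+ n)); first by rewrite lerXn2r ?nnegrE ?cabs_ge0 ?hq.
  by apply: (le_trans hn); rewrite ler_pM2l ?divr_gt0// den.
by have := hp z Az; lra.
Qed.

End PolynomialApproximation.

(** * Maximum principle for polynomials *)

Section MaximumModulus.
Variable R : realType.
Local Notation C := (cplx R).
Implicit Types (q : {poly C}) (z w : C) (M : R).

(** In characteristic zero ['X^n - 1] is separable, so it has [n] distinct roots, one of which is
    primitive. *)
Lemma prim_root_exists n : (0 < n)%N -> exists w : C, n.-primitive_root w.
Proof.
move=> n0; pose p : {poly C} := 'X^n - 1; have [r Dp] := closed_field_poly_normal p.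
rewrite (monicP _) ?monicXnsubC// scale1r in Dp.
have rn1 : all n.-unity_root r by apply/allP => z; rewrite -root_prod_XsubC -Dp.
have sz_r : (n < (size r).+1)%N by rewrite -(size_prod_XsubC r id) -Dp size_XnsubC.
have [|z _ hz] := hasP (has_prim_root n0 rn1 _ sz_r); last by exists z.
by rewrite -separable_prod_XsubC -Dp separable_Xn_sub_1// pnatr_eq0 -lt0n.
Qed.

Lemma cabs_prim_root n w : n.-primitive_root w -> cabs w = 1.
Proof.
move=> wn; have n0 := prim_order_gt0 wn.
have /eqP := prim_expr_order wn.
move=> /eqP/(congr1 (@cabs R)); rewrite cabsX cabs1 => /eqP.
by rewrite pexpr_eq1// ?cabs_ge0// => /eqP.
Qed.

Lemma cabs_sum (I : Type) (r : seq I) (F : I -> C) :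
  cabs (\sum_(i <- r) F i) <= \sum_(i <- r) cabs (F i).
Proof.
elim: r => [|i r IH]; first by rewrite !big_nil cabs0.
by rewrite !big_cons; apply: (le_trans (cabsD _ _)); rewrite lerD2l.
Qed.

Lemma poly_coef_le q M j : (forall z, cabs z = 1 -> cabs q.[z] <= M) -> cabs q`_j <= M.
Proof.
(* Discrete Fourier inversion on the N-th roots of unity. *)
move=> qM; pose N := maxn (size q) j.+1.
have jN : (j < N)%N by rewrite leq_max leqnn orbT.
have N0 : (0 < N)%N by exact: leq_ltn_trans jN.
have [w wN] := prim_root_exists N0.
have w1 := cabs_prim_root wN.
have w0 : w != 0 by rewrite -cabs_gt0 w1.
have E : \sum_(k < N) q.[w ^+ k] * (w ^+ j) ^- k = N%:R * q`_j.
  under eq_bigr => k _ do rewrite (@horner_coef_wide _ N) ?leq_maxl// mulr_suml.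
  rewrite exchange_big /= (bigD1 (Ordinal jN))//= [X in _ + X]big1 ?addr0 => [|i ij].
    rewrite -[N in N%:R]card_ord -sumr_const mulr_suml; apply: eq_bigr => k _.
    by rewrite -mulrA mul1r -!exprM [(k * j)%N]mulnC divff ?mulr1// expf_neq0.
  (* Both exponents are below [N], so for [i != j] the ratio [u] is an N-th root of unity other than
     1, and its powers sum to (u^N - 1) / (u - 1) = 0. *)
  pose u := w ^+ i / w ^+ j.
  under eq_bigr => k _.
    rewrite (_ : _ * _ = q`_i * u ^+ k); last first.
      by rewrite /u expr_div_n -!exprM [(k * i)%N]mulnC mulrA.
    over.
  have u1 : u - 1 != 0.
    rewrite subr_eq0; apply: contra ij => /eqP uE.
    have /eqP : w ^+ i = w ^+ j by rewrite -[RHS]mul1r -uE /u divfK// expf_neq0.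
    by rewrite (eq_prim_root_expr wN) !modn_small.
  rewrite -mulr_sumr (_ : \sum_(k < N) u ^+ k = 0) ?mulr0//; apply: (mulfI u1).
  rewrite mulr0 -subrX1 /u expr_div_n -!exprM ![(_ * N)%N]mulnC !exprM.
  by rewrite (prim_expr_order wN) !expr1n divr1 subrr.
have : cabs (N%:R * q`_j) <= N%:R * M.
  rewrite -E; apply: (le_trans (cabs_sum _ _)).
  rewrite -[N in leRHS]card_ord -sumr_const mulr_suml; apply: ler_sum => k _.
  by rewrite mul1r cabsM cabsV !cabsX w1 !expr1n invr1 mulr1 qM// cabsX w1 expr1n.
have -> : (N%:R : C) = cofr N%:R by rewrite /cofr rmorph_nat.
by rewrite cabsM cabs_cofr ger0_norm// ler_pM2l// ltr0n.
Qed.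

Lemma poly_max_modulus q M z : (forall w, cabs w = 1 -> cabs q.[w] <= M) ->
  cabs z < 1 -> cabs q.[z] <= M.
Proof.
move=> qM z1; have z0 := cabs_ge0 z.
have M0 : 0 <= M := le_trans (cabs_ge0 _) (qM 1 (@cabs1 R)).
(* The coefficient bound and the geometric series lose only the factor 1 / (1 - |z|), the same for
   all polynomials. *)
have crude (p : {poly C}) B : (forall w, cabs w = 1 -> cabs p.[w] <= B) ->
    (1 - cabs z) * cabs p.[z] <= B.
  move=> pB; have B0 : 0 <= B := le_trans (cabs_ge0 _) (pB 1 (@cabs1 R)).
  have le : cabs p.[z] <= B * \sum_(i < size p) cabs z ^+ i.
    rewrite horner_coef mulr_sumr; apply: (le_trans (cabs_sum _ _)); apply: ler_sum => i _.
    by rewrite cabsM cabsX ler_wpM2r ?exprn_ge0 ?poly_coef_le.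
  apply: (@le_trans _ _ ((1 - cabs z) * (B * \sum_(i < size p) cabs z ^+ i))).
    by rewrite ler_wpM2l// subr_ge0 ltW.
  rewrite mulrCA -opprB mulNr -subrX1 opprB -[leRHS]mulr1 ler_wpM2l//.
  by rewrite gerBl exprn_ge0.
(* Landau's trick: the crude bound applied to the powers of q. *)
rewrite leNgt; apply/negP => Mx.
have x0 : 0 < cabs q.[z] by exact: le_lt_trans Mx.
set y := M / cabs q.[z].
have y0 : 0 <= y by rewrite divr_ge0 ?cabs_ge0.
have y1 : y < 1 by rewrite ltr_pdivrMr ?mul1r.
have e0 : 0 < 1 - cabs z by rewrite subr_gt0.
have /cvgrPdist_lt/(_ _ e0)[n _ /(_ n (leqnn n))] :=
  @cvg_geometric R 1 y ltac:(by rewrite ger0_norm).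
rewrite /= sub0r normrN mul1r ger0_norm ?exprn_ge0// expr_div_n ltr_pdivrMr ?exprn_gt0//.
apply/negP; rewrite -leNgt.
have := crude (q ^+ n) (M ^+ n); rewrite horner_exp cabsX; apply => w w1.
by rewrite horner_exp cabsX lerXn2r ?nnegrE ?cabs_ge0// qM.
Qed.

Lemma peval_line d (p : mpoly.mpoly d C) (c v : Cn R d) :
  exists q : {poly C}, forall z, q.[z] = peval p (c + z *: v).
Proof.
exists (\sum_(m <- mpoly.msupp p) (mpoly.mcoeff m p)%:P *
  \prod_i ((c 0 i)%:P + (v 0 i) *: 'X) ^+ mpoly.fun_of_multinom m i) => z.
rewrite /peval mpoly.mevalE horner_sum; apply: eq_bigr => m _.
rewrite hornerM hornerC horner_prod; congr (_ * _); apply: eq_bigr => i _.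
by rewrite horner_exp !hornerE !mxE [z * _]mulrC.
Qed.

End MaximumModulus.

(** * Discs in the ball *)

Section BallGeometry.
Variables (R : realType) (d : nat).
Local Notation C := (cplx R).
Local Notation Re := (@complex.Re R).
Implicit Types (z w c u e : Cn R d) (a b t tau zeta : C).

Definition ip z w : C := \sum_j z 0 j * (w 0 j)^*.

Definition nsq z : R := \sum_j cabs (z 0 j) ^+ 2.

Lemma ipDl z1 z2 w : ip (z1 + z2) w = ip z1 w + ip z2 w.
Proof. by rewrite /ip -big_split; apply: eq_bigr => j _; rewrite mxE mulrDl. Qed.

Lemma ipZl a z w : ip (a *: z) w = a * ip z w.
Proof. by rewrite /ip mulr_sumr; apply: eq_bigr => j _; rewrite mxE mulrA. Qed.

Lemma ipC z w : (ip z w)^* = ip w z.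
Proof.
by rewrite /ip rmorph_sum; apply: eq_bigr => j _; rewrite rmorphM /= conjCK mulrC.
Qed.

Lemma ipDr z w1 w2 : ip z (w1 + w2) = ip z w1 + ip z w2.
Proof. by rewrite -ipC ipDl rmorphD /= !ipC. Qed.

Lemma ipZr a z w : ip z (a *: w) = a^* * ip z w.
Proof. by rewrite -ipC ipZl rmorphM /= ipC. Qed.

Lemma ipNl z w : ip (- z) w = - ip z w.
Proof. by rewrite -scaleN1r ipZl mulN1r. Qed.

Lemma ipNr z w : ip z (- w) = - ip z w.
Proof. by rewrite -ipC ipNl rmorphN /= ipC. Qed.

Lemma ip0l w : ip 0 w = 0.
Proof. by rewrite -(scale0r 0) ipZl mul0r. Qed.

Lemma ipE z : ip z z = cofr (nsq z).
Proof.
rewrite /ip /nsq /cofr rmorph_sum; apply: eq_bigr => j _.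
by rewrite -cofr_cabs_sqr.
Qed.

Lemma nsq_ge0 z : 0 <= nsq z.
Proof. by apply: sumr_ge0 => j _; exact: sqr_ge0. Qed.

Lemma cabs_coord_le z j : cabs (z 0 j) ^+ 2 <= nsq z.
Proof. by rewrite /nsq (bigD1 j)//= lerDl; apply: sumr_ge0 => k _; exact: sqr_ge0. Qed.

Lemma nsq_eq0 z : nsq z = 0 -> z = 0.
Proof.
move=> z0; apply/rowP => j; rewrite mxE; apply/eqP; rewrite -cabs_eq0 -sqrf_eq0.
by apply/eqP/le_anti; rewrite sqr_ge0 -z0 cabs_coord_le.
Qed.

Lemma nsqZ a z : nsq (a *: z) = cabs a ^+ 2 * nsq z.
Proof. by rewrite /nsq mulr_sumr; apply: eq_bigr => j _; rewrite mxE cabsM exprMn. Qed.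

Lemma unit_ballE z : unit_ball R d z <-> nsq z < 1.
Proof.
rewrite /unit_ball /= -ltr_cofr cofr1 -ipE /ip.
by under eq_bigr => j _ do rewrite normCK.
Qed.

Lemma cabs_sqr_ip z w : cofr (cabs (ip z w) ^+ 2) = ip z w * ip w z.
Proof. by rewrite cofr_cabs_sqr ipC. Qed.

Lemma pythagoras e u : nsq u = 1 ->
  nsq e = nsq (e - ip e u *: u) + cabs (ip e u) ^+ 2.
Proof.
move=> u1; apply: (@cofr_inj R).
rewrite cofrD cabs_sqr_ip -!ipE !(ipDl, ipDr, ipNl, ipNr, ipZl, ipZr) !ipC (ipE u) u1 cofr1.
ring.
Qed.

Lemma bessel e u : nsq u = 1 -> cabs (ip e u) ^+ 2 <= nsq e.
Proof. by move=> u1; rewrite (pythagoras e u1) lerDr nsq_ge0. Qed.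

Lemma cauchy_schwarz z w : cabs (ip z w) ^+ 2 <= nsq z * nsq w.
Proof.
have := nsq_ge0 w; rewrite le_eqVlt => /predU1P[/esym/nsq_eq0 ->|w0].
  by rewrite -ipC ip0l rmorph0 cabs0 expr0n mulr_ge0 ?nsq_ge0.
have E : nsq (cofr (nsq w) *: z - ip z w *: w) = nsq w * (nsq z * nsq w - cabs (ip z w) ^+ 2).
  apply: (@cofr_inj R); rewrite cofrM cofrB cofrM cabs_sqr_ip -!ipE.
  rewrite !(ipDl, ipDr, ipNl, ipNr, ipZl, ipZr) !ipC; ring.
by rewrite -subr_ge0 -(pmulr_rge0 _ w0) -E nsq_ge0.
Qed.

(* This is |1 - <z,c>|^2 (1 - |T z|^2) = (1 - |c|^2) (1 - |z|^2) for the automorphism [T] of the ball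
   exchanging [0] and [c], in a form that does not mention [T]. *)
Lemma ball_automorphism_identity z c :
  cabs (1 - ip z c) ^+ 2 =
  (1 - nsq c) * nsq (z - c) + (1 - nsq c) * (1 - nsq z) + cabs (ip (z - c) c) ^+ 2.
Proof.
apply: (@cofr_inj R); rewrite cofrD (cofrD (_ * _)) !(cofrM (1 - _)) !cofrB cofr1.
rewrite cabs_sqr_ip cofr_cabs_sqr -!ipE.
rewrite !(ipDl, ipDr, ipNl, ipNr) rmorphB rmorph1 /= ipC; ring.
Qed.

Section Disc.
Variables (c u : Cn R d).
Hypotheses (c1 : nsq c < 1) (u1 : nsq u = 1) (cu : ip c u = 0).

Definition disc_radius : R := Num.sqrt (1 - nsq c).
Local Notation r := disc_radius.

(** As [c] is orthogonal to [u], it is the point closest to 0 on the line, and the radius makes the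
    open unit disc parametrize the trace of the line on the ball. *)
Definition disc zeta : Cn R d := c + zeta *: (cofr r *: u).

(** Up to sign, the component along [u] of the automorphism of the ball exchanging 0 and [c]; it is
    a left inverse of [disc] that makes sense on the whole ball. *)
Definition disc_coord z : C := cofr r * ip z u / (1 - ip z c).

Let ip_uc : ip u c = 0.
Proof. by rewrite -ipC cu rmorph0. Qed.

Lemma disc_radius_gt0 : 0 < r.
Proof. by rewrite sqrtr_gt0 subr_gt0. Qed.

Lemma disc_radius_sqr : r ^+ 2 = 1 - nsq c.
Proof. by rewrite sqr_sqrtr// subr_ge0 ltW. Qed.

Lemma disc_radius_le1 : r <= 1.
Proof.
rewrite -(@expr_le1 _ 2)// ?(ltW disc_radius_gt0)// disc_radius_sqr.
by rewrite gerBl nsq_ge0.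
Qed.

Let rn0 : cofr r != 0.
Proof. by rewrite -cabs_gt0 cabs_cofr normr_gt0 gt_eqF// disc_radius_gt0. Qed.

Lemma nsq_disc zeta : nsq (disc zeta) = nsq c + cabs zeta ^+ 2 * r ^+ 2.
Proof.
apply: (@cofr_inj R); rewrite cofrD (cofrM (_ ^+ 2)) cofr_cabs_sqr cofrX -!ipE.
rewrite /disc !(ipDl, ipDr, ipZl, ipZr) cu ip_uc (ipE u) u1 cofr1 conj_cofr; ring.
Qed.

Lemma disc_in_ball zeta : cabs zeta < 1 -> nsq (disc zeta) < 1.
Proof.
move=> z1; rewrite nsq_disc disc_radius_sqr.
have : cabs zeta ^+ 2 < 1 by rewrite expr_lt1 ?cabs_ge0.
have := subr_gt0 (nsq c) 1; rewrite c1 => p; nra.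
Qed.

Lemma discK zeta : disc_coord (disc zeta) = zeta.
Proof.
rewrite /disc_coord /disc !(ipDl, ipZl) cu ip_uc (ipE u) u1 cofr1 ipE !mulr0 addr0 add0r mulr1.
have -> : 1 - cofr (nsq c) = cofr r ^+ 2 by rewrite -cofrX disc_radius_sqr cofrB.
by field.
Qed.

Lemma discP z (b : C) : nsq z < 1 -> z = c + b *: u -> exists2 zeta, cabs zeta < 1 & z = disc zeta.
Proof.
move=> z1 zE; have E : z = disc (b / cofr r) by rewrite /disc scalerA divfK.
exists (b / cofr r) => //; rewrite -(@expr_lt1 _ 2)// ?cabs_ge0//.
have r2 : 0 < r ^+ 2 by rewrite exprn_gt0// disc_radius_gt0.
rewrite -(ltr_pM2r r2) mul1r.
by move: z1; rewrite E nsq_disc -ltrBrDl disc_radius_sqr.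
Qed.

Lemma disc_den_neq0 z : nsq z < 1 -> 1 - ip z c != 0.
Proof.
move=> z1; rewrite -cabs_gt0 lt_def cabs_ge0 andbT.
rewrite -sqrf_eq0 gt_eqF// ball_automorphism_identity.
rewrite -addrA ltr_wpDl ?mulr_ge0 ?nsq_ge0 ?subr_ge0 ?(ltW c1)//.
by rewrite ltr_wpDr ?sqr_ge0// mulr_gt0// subr_gt0.
Qed.

Lemma ip_discE z : ip z u = ip (z - c) u.
Proof. by rewrite ipDl ipNl cu subr0. Qed.

Lemma cabs_disc_coord z : nsq z < 1 ->
  cabs (disc_coord z) ^+ 2 * cabs (1 - ip z c) ^+ 2 = r ^+ 2 * cabs (ip z u) ^+ 2.
Proof.
move=> z1; rewrite -!exprMn -cabsM divfK ?disc_den_neq0// cabsM cabs_cofr ger0_norm//.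
exact/ltW/disc_radius_gt0.
Qed.

(** By the automorphism identity |1 - <z,c>|^2 is larger than r^2 |z - c|^2, which dominates r^2
    |<z,u>|^2 by Bessel's inequality. *)
Lemma disc_coord_lt1 z : nsq z < 1 -> cabs (disc_coord z) < 1.
Proof.
move=> z1; have E := cabs_disc_coord z1.
have D0 : 0 < cabs (1 - ip z c) ^+ 2 by rewrite exprn_gt0// cabs_gt0 disc_den_neq0.
rewrite -(@expr_lt1 _ 2)// ?cabs_ge0// -(ltr_pM2r D0) mul1r E ball_automorphism_identity.
rewrite disc_radius_sqr ip_discE.
have b := bessel (z - c) u1; have s := sqr_ge0 (cabs (ip (z - c) c)).
have p : 0 < 1 - nsq c by rewrite subr_gt0.
have : (1 - nsq c) * cabs (ip (z - c) u) ^+ 2 <= (1 - nsq c) * nsq (z - c) by rewrite ler_pM2l.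
have : 0 < (1 - nsq c) * (1 - nsq z) by rewrite mulr_gt0// subr_gt0.
lra.
Qed.

(** The automorphism identity writes |D|^2 (1 - |p|^2) as a sum of nonnegative terms, among them r^2
    |e'|^2 and |a|^2. So when [p] is close to the unit circle, both the part [e'] of z - c
    orthogonal to [u] and a = <z - c, c> are small; the component along [u] is then recovered from
    [p] and [a]. *)
Lemma disc_coord_near z tau : nsq z < 1 -> cabs tau = 1 ->
  r ^+ 2 * nsq (z - disc tau) <= 28 * cabs (disc_coord z - tau).
Proof.
move=> z1 tau1; set p := disc_coord z; set x := cabs (p - tau).
have x0 : 0 <= x by exact: cabs_ge0.
have p1 : cabs p < 1 by exact: disc_coord_lt1.
have p0 : 0 <= cabs p by exact: cabs_ge0.
have x2 : x <= 2 by apply: (le_trans (cabsB _ _)); rewrite tau1; lra.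
have px : 1 - cabs p <= x.
  have := cabsB p (p - tau); rewrite subKr tau1 -/x; lra.
have p2x : 1 - cabs p ^+ 2 <= 2 * x by nra.
set e := z - c; set D := 1 - ip z c; set a := ip e c.
have DE : D = cofr r ^+ 2 - a.
  by rewrite /D /a /e ipDl ipNl ipE -cofrX disc_radius_sqr cofrB cofr1; ring.
have D2 : cabs D ^+ 2 <= 4.
  have h : cabs (ip z c) ^+ 2 <= 1.
    apply: (le_trans (cauchy_schwarz z c)); rewrite -[leRHS]mulr1.
    by rewrite ler_pM ?nsq_ge0// ltW.
  have : cabs D <= 2.
    apply: (le_trans (cabsB _ _)); rewrite cabs1.
    by move: h; rewrite expr_le1 ?cabs_ge0//; lra.
  have := cabs_ge0 D; nra.
have r0 := disc_radius_gt0; have r1 := disc_radius_le1.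
have E := cabs_disc_coord z1.
have I := ball_automorphism_identity z c.
rewrite -/p -/D ip_discE -/e in E; rewrite -/D -/e -/a -disc_radius_sqr in I.
have P := pythagoras e u1; set e' := e - ip e u *: u in P.
rewrite P in I.
have e'0 := nsq_ge0 e'.
have bound : r ^+ 2 * nsq e' + cabs a ^+ 2 <= 8 * x.
  have : 0 <= r ^+ 2 * (1 - nsq z) by rewrite mulr_ge0 ?sqr_ge0// subr_ge0 ltW.
  have : (1 - cabs p ^+ 2) * cabs D ^+ 2 <= 2 * x * 4.
    by apply: ler_pM => //; rewrite ?sqr_ge0// subr_ge0 expr_le1// ltW.
  have I' : cabs D ^+ 2 = r ^+ 2 * nsq e' + r ^+ 2 * cabs (ip e u) ^+ 2 +
     r ^+ 2 * (1 - nsq z) + cabs a ^+ 2 by rewrite I; ring.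
  rewrite mulrBl mul1r E; lra.
have S : nsq (z - disc tau) = nsq e' + cabs (ip e u - tau * cofr r) ^+ 2.
  have -> : z - disc tau = e - tau *: (cofr r *: u) by rewrite /disc opprD addrA.
  have ipe : ip (e - tau *: (cofr r *: u)) u = ip e u - tau * cofr r.
    by rewrite ipDl ipNl !ipZl (ipE u) u1 cofr1 mulr1.
  have := pythagoras (e - tau *: (cofr r *: u)) u1; rewrite ipe => ->.
  have -> // : e - tau *: (cofr r *: u) - (ip e u - tau * cofr r) *: u = e'.
  by rewrite scalerBl scalerA opprB addrA subrK.
(* This follows from p D = r <e,u> and D = r^2 - a. *)
have T : cofr r * (ip e u - tau * cofr r) = cofr r ^+ 2 * (p - tau) - p * a.
  have : p * D = cofr r * ip e u by rewrite /p /disc_coord divfK ?disc_den_neq0// ip_discE.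
  by rewrite DE => h; rewrite mulrBr -h; ring.
have T2 : r ^+ 2 * cabs (ip e u - tau * cofr r) ^+ 2 <= 2 * x ^+ 2 + 2 * cabs a ^+ 2.
  have -> : r ^+ 2 * cabs (ip e u - tau * cofr r) ^+ 2 = cabs (cofr r * (ip e u - tau * cofr r)) ^+ 2.
    by rewrite cabsM cabs_cofr (ger0_norm (ltW r0)) exprMn.
  rewrite T.
  have : cabs (cofr r ^+ 2 * (p - tau) - p * a) <= x + cabs a.
    apply: (le_trans (cabsB _ _)); rewrite (cabsM (cofr r ^+ 2)) (cabsM p).
    rewrite cabsX cabs_cofr (ger0_norm (ltW r0)) -/x.
    have h1 : r ^+ 2 * x <= x by rewrite ler_piMl// expr_le1// ltW.
    have h2 : cabs p * cabs a <= cabs a by rewrite ler_piMl ?cabs_ge0// ltW.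
    lra.
  have a0 := cabs_ge0 a; rewrite -ler_sqr ?nnegrE ?cabs_ge0 ?addr_ge0// => h.
  apply: (le_trans h); have := sqr_ge0 (x - cabs a); rewrite sqrrB sqrrD; lra.
rewrite S mulrDr.
have : x ^+ 2 <= 2 * x by rewrite expr2 ler_wpM2r.
have := sqr_ge0 (cabs a).
have : 0 <= r ^+ 2 * nsq e' by rewrite mulr_ge0// sqr_ge0.
lra.
Qed.

End Disc.

(** With [u] the unit direction of the line, [c] is the foot of the perpendicular from 0. *)
Lemma exists_disc z w : nsq z < 1 -> z != w -> exists c u,
  [/\ nsq c < 1, nsq u = 1, ip c u = 0 &
      forall t, nsq (z + t *: (w - z)) < 1 ->
        exists2 zeta, cabs zeta < 1 & z + t *: (w - z) = disc c u zeta].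
Proof.
move=> z1 zw; set v := w - z.
have v0 : 0 < nsq v.
  rewrite lt_def nsq_ge0 andbT; apply: contra zw => /eqP/nsq_eq0/eqP.
  by rewrite subr_eq0 eq_sym.
pose n : R := Num.sqrt (nsq v).
have n0 : 0 < n by rewrite sqrtr_gt0.
have nn0 : cofr n != 0 by rewrite -cabs_gt0 cabs_cofr normr_gt0 gt_eqF.
pose u : Cn R d := (cofr n)^-1 *: v.
have u1 : nsq u = 1.
  rewrite nsqZ cabsV cabs_cofr ger0_norm ?(ltW n0)// exprVn sqr_sqrtr ?(ltW v0)//.
  by rewrite mulVf// gt_eqF.
have vE : v = cofr n *: u by rewrite scalerA divff// scale1r.
pose c := z - ip z u *: u.
have c1 : nsq c < 1.
  by apply: le_lt_trans z1; rewrite (pythagoras z u1) lerDl sqr_ge0.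
have cu : ip c u = 0 by rewrite ipDl ipNl ipZl (ipE u) u1 cofr1 mulr1 subrr.
exists c, u; split => // t tz; apply: (discP c1 u1 cu tz (b := ip z u + t * cofr n)).
by rewrite /c vE scalerA scalerDl addrA subrK.
Qed.

End BallGeometry.

(** * Discs through two points *)

Section Geodesics.
Variables (R : realType) (d : nat).
Local Notation C := (cplx R).
Local Notation B := (unit_ball R d).
Implicit Types (z w c u : Cn R d) (a b t tau zeta : C) (V : set (Cn R d)).

Lemma differentiable_disc c u zeta : differentiable (disc c u : C -> Cn R d) zeta.
Proof.
apply: (@differentiableD _ _ _ (cst c) (fun t : C => t *: (cofr (disc_radius c) *: u) : Cn R d)).
  exact: differentiable_cst.
exact: (@differentiableZl _ _ _ id).
Qed.

Lemma schwarz_pick_disc (F : Cn R d -> C) c u a b : nsq c < 1 -> nsq u = 1 -> ip c u = 0 ->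
    holomorphic_on (W := C) B F -> (forall z, B z -> cabs (F z) < 1) ->
    cabs a < 1 -> cabs b < 1 -> F (disc c u a) = 0 ->
  cabs (F (disc c u b)) <= cabs (mobius (- a) b).
Proof.
move=> c1 u1 cu dF F1 a1 b1 Fa.
have dB zeta : cabs zeta < 1 -> B (disc c u zeta).
  by move=> z1; apply/unit_ballE; exact: disc_in_ball.
apply: (@schwarz_pick _ (F \o disc c u)) => //.
- move=> w w1; apply/derivable1_diffP.
  by apply: differentiable_comp; [exact: differentiable_disc|exact/dF/dB].
- by move=> w w1; exact/F1/dB.
Qed.

Lemma extension_bound V (p : mpoly.mpoly d C) (M : R) : extension_property B V ->
    (forall z, V z -> cabs (peval p z) <= M) ->
  exists F : Cn R d -> C, [/\ holomorphic_on (W := C) B F,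
    forall z, B z -> cabs (F z) <= M & forall z, V z -> F z = peval p z].
Proof.
move=> ext pM; have [F [[dF _] FV FN]] := ext p.
exists F; split => // z Bz; rewrite -lee_fin.
apply: (@le_trans _ _ (supnorm B F)); first by apply: ereal_sup_ubound; exists z.
by rewrite FN; apply: ge_ereal_sup => _ [w Vw <-]; rewrite lee_fin pM.
Qed.

(** The polynomials used later vanish at the first point only approximately, so the value there is
    subtracted before the Schwarz-Pick lemma is applied, which enlarges the bound by its modulus. *)
Lemma extension_schwarz V (p : mpoly.mpoly d C) (M : R) c u a b :
    extension_property B V -> (forall z, V z -> cabs (peval p z) <= M) ->
    nsq c < 1 -> nsq u = 1 -> ip c u = 0 -> cabs a < 1 -> cabs b < 1 ->
    V (disc c u a) -> V (disc c u b) ->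
  cabs (peval p (disc c u b) - peval p (disc c u a)) <=
    (M + cabs (peval p (disc c u a))) * cabs (mobius (- a) b).
Proof.
move=> ext pM c1 u1 cu a1 b1 Va Vb; have [F [dF FM FV]] := extension_bound ext pM.
set k := peval p (disc c u a); set m := cabs (mobius _ _).
have m01 : 0 <= m <= 1 by rewrite cabs_ge0 mobius_le1 ?cabsN// ltW.
have M0 : 0 <= M := le_trans (cabs_ge0 _) (pM _ Va).
have k0 := cabs_ge0 k.
apply/ler_addgt0Pl => e e0.
(* The summand [e] makes the normalized function strictly smaller than 1 in modulus and [N]
   nonzero. *)
pose N := M + cabs k + e; have N0 : 0 < N by rewrite /N; lra.
have cN0 : cofr N != 0 by rewrite -cabs_gt0 cabs_cofr normr_gt0 gt_eqF.
pose G z : C := (F z - k) * (cofr N)^-1.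
have NG z : cabs (G z) = cabs (F z - k) / N by rewrite cabsM cabsV cabs_cofr (gtr0_norm N0).
have dG : holomorphic_on (W := C) B G.
  move=> z Bz; apply: (@differentiableM _ _ (fun z => F z - k) (cst (cofr N)^-1)).
    by apply: (@differentiableB _ _ _ F (cst k)); [exact: dF|exact: differentiable_cst].
  exact: differentiable_cst.
have G1 z : B z -> cabs (G z) < 1.
  move=> Bz; rewrite NG ltr_pdivrMr// mul1r; apply: (le_lt_trans (cabsB _ _)).
  by have := FM z Bz; rewrite /N; lra.
have := schwarz_pick_disc c1 u1 cu dG G1 a1 b1; rewrite /G FV// subrr mul0r => /(_ erefl).
rewrite -/(G _) NG FV// ler_pdivrMr// -/m => h; apply: (le_trans h).
by rewrite /N; case/andP: m01 => m0 m1; nra.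
Qed.

(** The extension property speaks of polynomials; approximation within [e / 4] costs an error at
    each of the two points and an excess of the bound on [V], together at most [e]. *)
Lemma approximable_schwarz V (h : Cn R d -> C) c u a b :
    V `<=` B -> extension_property B V -> poly_approximable B h ->
    (forall z, V z -> cabs (h z) <= 1) ->
    nsq c < 1 -> nsq u = 1 -> ip c u = 0 -> cabs a < 1 -> cabs b < 1 ->
    V (disc c u a) -> V (disc c u b) -> h (disc c u a) = 0 ->
  cabs (h (disc c u b)) <= cabs (mobius (- a) b).
Proof.
move=> VB ext [_ ah] h1 c1 u1 cu a1 b1 Va Vb ha.
set m := cabs (mobius _ _).
have m01 : 0 <= m <= 1 by rewrite cabs_ge0 mobius_le1 ?cabsN// ltW.
apply/ler_addgt0Pl => e e0; have e4 : 0 < e / 4 by lra.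
have [p hp] := ah _ e4.
have pM z : V z -> cabs (peval p z) <= 1 + e / 4.
  move=> Vz; rewrite -(subKr (h z) (peval p z)); apply: (le_trans (cabsB _ _)).
  by have := hp z (VB z Vz); have := h1 z Vz; lra.
have := extension_schwarz ext pM c1 u1 cu a1 b1 Va Vb; rewrite -/m.
have pa := hp _ (VB _ Va); have pb := hp _ (VB _ Vb); rewrite ha sub0r cabsN in pa.
set x := peval p (disc c u a) in pa *; set y := peval p (disc c u b) in pb *.
move=> le; rewrite -(subrK y (h _)) -(subrK x y) addrA.
rewrite {1}(subrK x y); apply: (le_trans (cabsD _ _)).
apply: (le_trans (lerD (cabsD _ _) (lexx _))).
have x0 := cabs_ge0 x; case/andP: m01 => m0 m1.
have : (e / 4 + cabs x) * m <= e / 2 * 1 by apply: ler_pM => //; clear -e0 x0 pa; lra.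
have arith (A X D : R) : A <= (1 + e / 4 + X) * m -> X <= e / 4 -> D <= e / 4 ->
    (e / 4 + X) * m <= e / 2 * 1 -> D + A + X <= e + m by clear; lra.
exact: arith le pa pb.
Qed.

Lemma approximable_ip c : poly_approximable B (fun z => ip z c).
Proof.
apply: approximable_sum => j; apply: approximableM; last exact: approximable_cst.
apply: approximable_coord; exists 1 => z /unit_ballE z1.
by rewrite -(@expr_le1 _ 2)// ?cabs_ge0// ltW// (le_lt_trans (cabs_coord_le z j)).
Qed.

Lemma approximable_disc_coord c u : nsq c < 1 -> poly_approximable B (disc_coord c u).
Proof.
move=> c1; apply: approximableM.
  by apply: approximableM; [exact: approximable_cst|exact: approximable_ip].
apply: (@approximable_geometric _ _ _ _ (Num.sqrt (nsq c))); first exact: approximable_ip.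
  by rewrite -sqrtr1 ltr_sqrt.
move=> z /unit_ballE z1; rewrite -ler_sqr ?nnegrE ?cabs_ge0 ?sqrtr_ge0// sqr_sqrtr ?nsq_ge0//.
apply: (le_trans (cauchy_schwarz z c)).
by rewrite ler_piMl ?nsq_ge0// ltW.
Qed.

(** Both denominators are geometric series in the disc coordinate, with ratios |a| and 1 / (1 + h);
    the latter is below 1 because the pole of the bump lies outside the closed disc. *)
Lemma approximable_extremal c u a tau (h e k : R) :
    nsq c < 1 -> nsq u = 1 -> ip c u = 0 -> cabs a < 1 -> cabs tau = 1 -> 0 < h ->
  poly_approximable B (fun z => mobius (- a) (disc_coord c u z) * bump tau h e k (disc_coord c u z)).
Proof.
move=> c1 u1 cu a1 tau1 h0.
have aphi := approximable_disc_coord u c1.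
have phi1 z : B z -> cabs (disc_coord c u z) <= 1.
  by move=> /unit_ballE z1; exact/ltW/disc_coord_lt1.
apply: approximableM.
  apply: approximableM; first by apply: approximableD => //; exact: approximable_cst.
  under eq_fun do rewrite -[X in 1 + X]opprK.
  apply: (@approximable_geometric _ _ _ (fun z => - ((- a)^* * disc_coord c u z)) (cabs a)) => //.
    under eq_fun do rewrite -mulNr.
    by apply: approximableM => //; exact: approximable_cst.
  by move=> z /phi1 z1; rewrite cabsN cabsM cabs_conj cabsN ler_piMr ?cabs_ge0.
apply: approximableD; first exact: approximable_cst.
apply: approximableM; first exact: approximable_cst.
apply: approximableD; last exact: approximable_cst.
apply: approximableM; first by apply: approximableD => //; exact: approximable_cst.
set T := cofr (1 + h) * tau.
have Tn : cabs T = 1 + h by rewrite cabsM cabs_cofr tau1 mulr1 gtr0_norm//; lra.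
have T0 : T != 0 by rewrite -cabs_gt0 Tn; lra.
have -> : (fun z => (T - disc_coord c u z)^-1) = (fun z => T^-1 * (1 - T^-1 * disc_coord c u z)^-1).
  by apply/funext => z; rewrite -invfM mulrBr mulr1 mulrA divff// mul1r.
apply: approximableM; first exact: approximable_cst.
apply: (@approximable_geometric _ _ _ _ (1 + h)^-1).
- by apply: approximableM => //; exact: approximable_cst.
- by rewrite invf_lt1; lra.
- by move=> z /phi1 z1; rewrite cabsM cabsV Tn ler_piMr// invr_ge0; lra.
Qed.

(** The topology of [Cn] comes from the max norm, which the Euclidean norm dominates; [r] bounds a
    squared distance. *)
Lemma not_closure_far V z : ~ closure V z -> exists2 r : R, 0 < r & forall w, V w -> r <= nsq (w - z).
Proof.
move=> nc; have [U [nU UV]] : exists U, nbhs z U /\ ~ (V `&` U !=set0).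
  by move: nc; rewrite /closure /= => /existsNP[U /not_implyP[? ?]]; exists U.
have /nbhs_ballP[e0 /= /cplx_gt0[r r0 ->] ballU] := nU.
exists (r ^+ 2); first by rewrite exprn_gt0.
move=> w Vw; rewrite leNgt; apply/negP => lt; apply: UV; exists w; split=> //; apply: ballU.
split; first by rewrite -cofr0 ltr_cofr.
move=> i j; rewrite !ord1 /ball /= normE ltr_cofr cabs_distC.
rewrite -ltr_sqr ?nnegrE ?cabs_ge0 ?(ltW r0)//; apply: le_lt_trans lt.
by have := cabs_coord_le (w - z) j; rewrite !mxE.
Qed.

Lemma disc_boundary_closure V c u a b tau : V `<=` B -> extension_property B V ->
    nsq c < 1 -> nsq u = 1 -> ip c u = 0 -> cabs a < 1 -> cabs b < 1 -> a != b ->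
    V (disc c u a) -> V (disc c u b) -> cabs tau = 1 ->
  closure V (disc c u tau).
Proof.
move=> VB ext c1 u1 cu a1 b1 ab Va Vb tau1; apply: contrapT => /not_closure_far[r r0 far].
have R0 := disc_radius_gt0 c1; set rho := disc_radius c in R0 *.
(* Through [disc_coord_near], squared distance at least [r] from the boundary point forces the disc
   coordinate to stay at distance at least [delta] from [tau]. *)
pose delta := rho ^+ 2 * r / 28.
have delta0 : 0 < delta by rewrite divr_gt0// mulr_gt0// exprn_gt0.
have [h [e [k [h0 small big]]]] := exists_bump a1 b1 ab tau1 delta0.
have := approximable_schwarz VB ext (approximable_extremal e k c1 u1 cu a1 tau1 h0) _ c1 u1 cu a1 b1 Va Vb.
rewrite !discK// mobiusNx mul0r => H.
have := lt_le_trans big (H _ erefl); rewrite ltxx => F.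
apply: notF; apply: F => z Vz; have z1 : nsq z < 1 by exact/unit_ballE/VB.
apply: small; first exact/ltW/disc_coord_lt1.
rewrite /delta ler_pdivrMr// [leRHS]mulrC; apply: le_trans (disc_coord_near c1 u1 cu z1 tau1).
by rewrite ler_wpM2l ?sqr_ge0// far.
Qed.

Lemma disc_subset V c u a b zeta : V `<=` B -> extension_property B V ->
    relatively_polynomially_convex B V ->
    nsq c < 1 -> nsq u = 1 -> ip c u = 0 -> cabs a < 1 -> cabs b < 1 -> a != b ->
    V (disc c u a) -> V (disc c u b) -> cabs zeta < 1 ->
  V (disc c u zeta).
Proof.
move=> VB ext [cV hull] c1 u1 cu a1 b1 ab Va Vb z1.
rewrite -cV; split; last by apply/unit_ballE; exact: disc_in_ball.
rewrite -hull => p.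
have bd tau : cabs tau = 1 -> ((cabs (peval p (disc c u tau)))%:E <= supnorm (closure V) (peval p))%E.
  move=> tau1; apply: ereal_sup_ubound; exists (disc c u tau) => //.
  exact: (disc_boundary_closure VB ext c1 u1 cu a1 b1 ab).
have [q qE] := peval_line p c (cofr (disc_radius c) *: u).
have bd1 := bd 1 (@cabs1 R).
(* The supremum is an extended real: -oo is excluded by the boundary point at 1, and for +oo the
   bound is trivial. *)
case E : (supnorm (closure V) (peval p)) bd bd1 => [M| |] bd bd1; first last.
- by exfalso; move: bd1; clear; rewrite leNgt ltNyr.
- exact: leey.
rewrite lee_fin /disc -qE.
apply: poly_max_modulus => // w w1.
by rewrite qE -lee_fin; exact: bd.
Qed.

Lemma line_subset V z w t : V `<=` B -> extension_property B V ->
    relatively_polynomially_convex B V -> V z -> V w -> z != w ->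
  B (z + t *: (w - z)) -> V (z + t *: (w - z)).
Proof.
move=> VB ext conv Vz Vw zw /unit_ballE tB.
have z1 : nsq z < 1 by exact/unit_ballE/VB.
have w1 : nsq w < 1 by exact/unit_ballE/VB.
have [c [u [c1 u1 cu onto]]] := exists_disc z1 zw.
have [a a1 za] := onto 0 ltac:(by rewrite scale0r addr0).
have [b b1 wb] := onto 1 ltac:(by rewrite scale1r addrC subrK).
rewrite scale0r addr0 in za; rewrite scale1r addrC subrK in wb.
have [zeta zeta1 ->] := onto t tB.
apply: (disc_subset VB ext conv c1 u1 cu a1 b1) => //; rewrite -?za -?wb//.
by apply: contra zw => /eqP ab; rewrite za wb ab.
Qed.

End Geodesics.

(** * Trace of an affine subspace *)

Section OrthonormalRows.
Variables (R : realType) (d : nat).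
Local Notation C := (cplx R).

Definition adjoint m n (A : 'M[C]_(m, n)) : 'M[C]_(n, m) := (map_mx Num.conj A)^T.

Lemma adjointK m n (A : 'M[C]_(m, n)) : adjoint (adjoint A) = A.
Proof. by apply/matrixP => i j; rewrite !mxE conjCK. Qed.

Lemma adjointM m n p (A : 'M[C]_(m, n)) (B : 'M[C]_(n, p)) :
  adjoint (A *m B) = adjoint B *m adjoint A.
Proof. by rewrite /adjoint map_mxM trmx_mul. Qed.

Lemma ipM (z w : Cn R d) : ip z w = (z *m adjoint w) 0 0.
Proof. by rewrite mxE /ip; apply: eq_bigr => j _; rewrite !mxE. Qed.

Definition orthonormal_rows k (E : 'M[C]_(k, d)) : Prop := E *m adjoint E = 1%:M.

Definition rows_proj k (E : 'M[C]_(k, d)) (z : Cn R d) : Cn R d := z *m adjoint E *m E.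

(* The rows of a maximal orthonormal matrix with row space in [W]. *)
Lemma exists_orthonormal_basis (W : set (Cn R d)) : W 0 ->
    (forall a w, W w -> W (a *: w)) -> (forall v w, W v -> W w -> W (v + w)) ->
  exists k (E : 'M[C]_(k, d)), [/\ orthonormal_rows E, forall x : 'rV_k, W (x *m E) &
    forall w, W w -> rows_proj E w = w].
Proof.
move=> W0 WZ WD.
pose P k := `[< exists E : 'M[C]_(k, d), orthonormal_rows E /\ forall x : 'rV_k, W (x *m E) >].
have P0 : exists k, P k.
  exists 0%N; apply/asboolP; exists 0; split; first by apply/matrixP => -[].
  by move=> x; rewrite mulmx0.
have Pd k : P k -> (k <= d)%N by move=> /asboolP[E [/mulmx1_min]].
case: (ex_maxnP P0 Pd) => k /asboolP[E [oE WE]] kmax.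
exists k, E; split => // w Ww.
(* If this component of [w] orthogonal to the rows were nonzero, it could be normalized and added as
   a further row, against the maximality of [k]. *)
pose e := w - rows_proj E w.
have We : W e.
  by apply: WD => //; rewrite -scaleN1r; apply/WZ/WE.
have eE : e *m adjoint E = 0.
  by rewrite mulmxBl /rows_proj -!mulmxA oE mulmx1 subrr.
have [/nsq_eq0/eqP|ne0] := eqVneq (nsq e) 0.
  by rewrite subr_eq0 => /eqP.
have e0 : 0 < nsq e by rewrite lt_def ne0 nsq_ge0.
pose s : C := (cofr (Num.sqrt (nsq e)))^-1.
have su : nsq (s *: e) = 1.
  rewrite nsqZ cabsV cabs_cofr ger0_norm ?sqrtr_ge0// exprVn sqr_sqrtr ?nsq_ge0//.
  by rewrite mulVf.
have : P (k + 1)%N.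
  apply/asboolP; exists (col_mx E (s *: e)); split.
    rewrite /orthonormal_rows /adjoint map_col_mx tr_col_mx mul_col_row -!/(adjoint _).
    rewrite oE (scalar_mx_block k 1); congr block_mx.
    - by rewrite -[E in LHS]adjointK -adjointM -scalemxAl eE scaler0 /adjoint map_mx0 trmx0.
    - by rewrite -scalemxAl eE scaler0.
    - by apply/matrixP => i j; rewrite !ord1 -ipM ipE su mxE.
  move=> x; rewrite -[x]hsubmxK mul_row_col; apply: WD => //.
  by rewrite [rsubmx x]mx11_scalar mul_scalar_mx; exact/WZ/WZ.
by move=> /kmax; rewrite addn1 ltnn.
Qed.

Section Projection.
Variables (k : nat) (E : 'M[C]_(k, d)).
Hypothesis oE : orthonormal_rows E.
Implicit Types z w : Cn R d.

Lemma rows_proj_id (x : 'rV_k) : rows_proj E (x *m E) = x *m E.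
Proof. by rewrite /rows_proj -(mulmxA x) oE mulmx1. Qed.

Lemma rows_projK z : rows_proj E (rows_proj E z) = rows_proj E z.
Proof. exact: rows_proj_id. Qed.

Lemma rows_projB z w : rows_proj E (z - w) = rows_proj E z - rows_proj E w.
Proof. by rewrite /rows_proj !mulmxBl. Qed.

Lemma ip_rows_proj z w : ip (rows_proj E z) w = ip z (rows_proj E w).
Proof. by rewrite !ipM /rows_proj !adjointM adjointK !mulmxA. Qed.

Lemma nsq_rows_proj z : nsq z = nsq (rows_proj E z) + nsq (z - rows_proj E z).
Proof.
apply: (@cofr_inj R); rewrite cofrD -!ipE !(ipDl, ipDr, ipNl, ipNr).
by rewrite !ip_rows_proj !rows_projK; ring.
Qed.

Lemma rows_proj_le z : nsq (rows_proj E z) <= nsq z.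
Proof. by rewrite (nsq_rows_proj z) lerDl nsq_ge0. Qed.

(** Scalar functions times fixed vectors: the form in which the retraction is shown to be
    differentiable. *)
Lemma rows_proj_sum z : rows_proj E z = \sum_i (z *m adjoint E) 0 i *: row i E.
Proof.
apply/rowP => j; rewrite mxE summxE; apply: eq_bigr => i _.
by rewrite !mxE.
Qed.

End Projection.
End OrthonormalRows.

(** * The retraction onto the trace of an affine subspace *)

Section Retraction.
Variables (R : realType) (d : nat).
Local Notation C := (cplx R).
Local Notation B := (unit_ball R d).
Implicit Types (z w v c : Cn R d) (a t : C) (V : set (Cn R d)).

Lemma differentiable_ip c z : differentiable (fun w => ip w c : C) z.
Proof.
have -> : (fun w => ip w c) = \sum_j (fun w : Cn R d => w 0 j * (c 0 j)^*).
  by apply/funext => w; rewrite fct_sumE.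
apply: differentiable_sum => j.
apply: (@differentiableM _ _ (fun w : Cn R d => w 0 j) (cst (c 0 j)^*)).
  exact: differentiable_coord.
exact: differentiable_cst.
Qed.

Definition retraction c k (E : 'M[C]_(k, d)) z : Cn R d :=
  c + (cofr (1 - nsq c) / (1 - ip z c)) *: rows_proj E z.

Lemma retraction_differentiable c k (E : 'M[C]_(k, d)) z : nsq c < 1 -> nsq z < 1 ->
  differentiable (retraction c E) z.
Proof.
move=> c1 z1.
have -> : retraction c E = cst c + \sum_i (fun w : Cn R d =>
    (cofr (1 - nsq c) * (1 - ip w c)^-1 * ip w (row i E)) *: row i E).
  apply/funext => w; rewrite /retraction fctE fct_sumE rows_proj_sum scaler_sumr; congr (_ + _).
  apply: eq_bigr => i _; rewrite scalerA; congr (_ * _ *: _).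
  by rewrite mxE; apply: eq_bigr => j _; rewrite !mxE.
apply: differentiableD; first exact: differentiable_cst.
apply: differentiable_sum => i.
apply: (@differentiableZl _ _ _ (fun w => cofr (1 - nsq c) * (1 - ip w c)^-1 * ip w (row i E))).
apply: (@differentiableM _ _ (fun w => cofr (1 - nsq c) * (1 - ip w c)^-1)); last exact: differentiable_ip.
apply: (@differentiableM _ _ (cst (cofr (1 - nsq c))) (fun w => (1 - ip w c)^-1)).
  exact: differentiable_cst.
apply: (@differentiableV _ _ (fun w => 1 - ip w c)); last exact: disc_den_neq0.
apply: (@differentiableB _ _ _ (cst (1 : C)) (fun w => ip w c)).
- exact: differentiable_cst.
- exact: differentiable_ip.
Qed.

(** As [c] is orthogonal to the range of the projection P, the squared norm of the image is |c|^2 +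
    |s|^2 |P z|^2. Since P z = P (z - c) has norm at most |z - c|, the automorphism identity bounds
    the second term by 1 - |c|^2, strictly. *)
Lemma retraction_in_ball c k (E : 'M[C]_(k, d)) z : orthonormal_rows E -> rows_proj E c = 0 ->
  nsq c < 1 -> nsq z < 1 -> nsq (retraction c E z) < 1.
Proof.
move=> oE Ec c1 z1; set s := cofr (1 - nsq c) / (1 - ip z c).
have r0 : 0 < 1 - nsq c by rewrite subr_gt0.
have cross : ip c (rows_proj E z) = 0 by rewrite -ip_rows_proj Ec ip0l.
have E1 : nsq (retraction c E z) = nsq c + cabs s ^+ 2 * nsq (rows_proj E z).
  rewrite /retraction -/s; set y := rows_proj E z in cross *.
  have cross' : ip y c = 0 by rewrite -ipC cross rmorph0.
  apply: (@cofr_inj R); rewrite cofrD (cofrM (_ ^+ 2)) cofr_cabs_sqr -!ipE.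
  by rewrite !(ipDl, ipDr, ipZl, ipZr) cross cross'; ring.
have Pz : rows_proj E z = rows_proj E (z - c) by rewrite rows_projB Ec subr0.
have D0 : 0 < cabs (1 - ip z c) ^+ 2 by rewrite exprn_gt0// cabs_gt0 disc_den_neq0.
rewrite E1 -ltrBrDl /s cabsM cabsV cabs_cofr (gtr0_norm r0) exprMn exprVn mulrAC.
rewrite ltr_pdivrMr// expr2 -mulrA ltr_pM2l// ball_automorphism_identity Pz.
have : (1 - nsq c) * nsq (rows_proj E (z - c)) <= (1 - nsq c) * nsq (z - c).
  by rewrite ler_pM2l// rows_proj_le.
have : 0 < (1 - nsq c) * (1 - nsq z) by rewrite mulr_gt0// subr_gt0.
move=> pos le; rewrite -addrA; apply: (le_lt_trans le); rewrite ltrDl.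
by rewrite ltr_wpDr ?sqr_ge0.
Qed.

(** On the affine subspace <z,c> = |c|^2, so the scalar factor is 1. *)
Lemma retraction_fixed c k (E : 'M[C]_(k, d)) z : orthonormal_rows E -> rows_proj E c = 0 ->
  nsq c < 1 -> rows_proj E (z - c) = z - c -> retraction c E z = z.
Proof.
move=> oE Ec c1 Pz.
have zE : z = c + rows_proj E z.
  by move: Pz; rewrite rows_projB Ec subr0 => ->; rewrite addrC subrK.
have zc : ip z c = cofr (nsq c).
  by rewrite zE ipDl ip_rows_proj Ec -[X in _ + X]ipC ip0l rmorph0 addr0 ipE.
have -> : retraction c E z = c + (cofr (1 - nsq c) / cofr (1 - nsq c)) *: rows_proj E z.
  by rewrite /retraction zc cofrB.
rewrite divff ?scale1r -?zE//.
by rewrite -cabs_eq0 cabs_cofr normr_eq0 gt_eqF// subr_gt0.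
Qed.

Lemma small_translation v w : nsq v < 1 ->
  exists2 e : R, 0 < e & forall s : R, 0 < s < e -> nsq (v + cofr s *: w) < 1.
Proof.
(* For 0 < s < 1 the squared norm grows by at most [s * K]; the summand 1 makes [K] positive. *)
move=> v1; pose K := 2 * cabs (ip v w) + nsq w + 1.
have K0 : 0 < K by have := cabs_ge0 (ip v w); have := nsq_ge0 w; rewrite /K; lra.
exists (Num.min 1 ((1 - nsq v) / K)).
  by rewrite lt_min ltr01 divr_gt0// subr_gt0.
move=> s /andP[s0]; rewrite lt_min ltr_pdivlMr// => /andP[s1 sK].
have -> : nsq (v + cofr s *: w) = nsq v + s * (2 * complex.Re (ip v w)) + s ^+ 2 * nsq w.
  rewrite -[LHS]/(complex.Re (cofr _)) -ipE !(ipDl, ipDr, ipZl, ipZr) -(ipC v w) conj_cofr !ipE.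
  by case: (ip v w) => x y /=; ring.
have h1 : s * (2 * complex.Re (ip v w)) <= s * (2 * cabs (ip v w)).
  rewrite ler_pM2l// ler_pM2l//; exact: le_trans (ler_norm _) (Re_le_cabs _).
have h2 : s ^+ 2 * nsq w <= s * nsq w by rewrite ler_wpM2r ?nsq_ge0// expr2 ler_piMl// ltW.
move: sK; rewrite /K; lra.
Qed.

(* Midpoints of points of [V] make the set of directions of [V] at [v] additive. *)
Lemma directions_subspace V v : V `<=` B -> V v ->
    (forall z w t, V z -> V w -> z != w -> B (z + t *: (w - z)) -> V (z + t *: (w - z))) ->
  let W : set (Cn R d) := [set w | forall t, B (v + t *: w) -> V (v + t *: w)] in
  [/\ W 0, forall a w, W w -> W (a *: w), forall w1 w2, W w1 -> W w2 -> W (w1 + w2) &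
      forall z, V z -> W (z - v)].
Proof.
move=> VB Vv line W.
have v1 : nsq v < 1 by exact/unit_ballE/VB.
have Wdir z : V z -> W (z - v).
  move=> Vz t; have [->|vz] := eqVneq v z; first by rewrite subrr scaler0 addr0.
  exact: line.
split => //.
- by move=> t; rewrite scaler0 addr0.
- by move=> a w Ww t; rewrite scalerA; exact: Ww.
move=> w1 w2 Ww1 Ww2.
have [e1 e10 H1] := small_translation w1 v1.
have [e2 e20 H2] := small_translation w2 v1.
have [e3 e30 H3] := small_translation (w1 + w2) v1.
pose e := Num.min e1 (Num.min e2 e3).
have e0 : 0 < e by rewrite !lt_min e10 e20.
have [ee1 ee2 ee3] : [/\ e <= e1, e <= e2 & e <= e3] by rewrite /e !ge_min !lexx !orbT.
(* The points at parameter [2 * s] in the directions [w1] and [w2] lie in [V], and their midpoint is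
   at parameter [s] in the direction [w1 + w2]. The factor [s] is removed at the end by rescaling
   [t]. *)
pose s := e / 4; have s0 : 0 < s by rewrite /s; lra.
have V1 : V (v + cofr (2 * s) *: w1).
  by apply: Ww1; apply/unit_ballE/H1; rewrite /s; apply/andP; split; lra.
have V2 : V (v + cofr (2 * s) *: w2).
  by apply: Ww2; apply/unit_ballE/H2; rewrite /s; apply/andP; split; lra.
have Bm : B (v + cofr s *: (w1 + w2)).
  by apply/unit_ballE/H3; rewrite /s; apply/andP; split; lra.
have Vm : V (v + cofr s *: (w1 + w2)).
  set z1 := v + _ in V1; set z2 := v + _ in V2.
  have mid : v + cofr s *: (w1 + w2) = z1 + cofr (1 / 2) *: (z2 - z1).
    have h : cofr (1 / 2) * cofr (2 * s) = cofr s by rewrite -cofrM; congr cofr; field.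
    rewrite /z1 /z2 opprD addrACA subrr add0r -scalerBr scalerA h scalerDr scalerBr.
    have -> : cofr (2 * s) = cofr s + cofr s by rewrite -cofrD; congr cofr; ring.
    by rewrite scalerDl -!addrA; congr (_ + (_ + _)); rewrite addrC subrK.
  rewrite mid in Bm *; have [z12|z12] := eqVneq z1 z2; last exact: line V1 V2 z12 Bm.
  by rewrite z12 subrr scaler0 addr0.
have := Wdir _ Vm; rewrite addrC addKr => Ws t.
have sn0 : cofr s != 0 by rewrite -cabs_gt0 cabs_cofr normr_gt0 gt_eqF.
by have := Ws (t / cofr s); rewrite scalerA divfK.
Qed.

Lemma line_closed_is_retract V v : V `<=` B -> V v ->
    (forall z w t, V z -> V w -> z != w -> B (z + t *: (w - z)) -> V (z + t *: (w - z))) ->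
  is_retract B V.
Proof.
move=> VB Vv line; have [W0 WZ WD Wdir] := directions_subspace VB Vv line.
set W := [set w | _] in W0 WZ WD Wdir.
have [k [E [oE WE PW]]] := exists_orthonormal_basis W0 WZ WD.
have v1 : nsq v < 1 by exact/unit_ballE/VB.
(* The point closest to 0 on the affine subspace through [v] with direction [W]. *)
pose c := v - rows_proj E v.
have Ec : rows_proj E c = 0 by rewrite rows_projB rows_projK// subrr.
have c1 : nsq c < 1.
  by apply: le_lt_trans v1; rewrite [leRHS](nsq_rows_proj oE) lerDr nsq_ge0.
have fixV z : V z -> retraction c E z = z.
  move=> Vz; apply: retraction_fixed => //.
  have -> : z - c = (z - v) + rows_proj E v by rewrite /c opprB addrA addrAC.
  by apply: PW; apply: WD; [exact: Wdir|exact: WE].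
have inV z : B z -> V (retraction c E z).
  move=> /unit_ballE z1.
  have Bz : B (retraction c E z) by apply/unit_ballE; exact: retraction_in_ball.
  set s := cofr (1 - nsq c) / (1 - ip z c) in Bz *.
  (* The image differs from [v] by a vector of [W], so being in the ball it belongs to [V]. *)
  have E1 : retraction c E z = v + 1 *: (s *: rows_proj E z - rows_proj E v).
    by rewrite scale1r /retraction -/s /c addrAC addrA.
  rewrite E1; rewrite E1 in Bz; move: Bz; apply: (WD _ _ _ _ 1); first exact/WZ/WE.
  by rewrite -scaleN1r; exact/WZ/WE.
exists (retraction c E); split.
- by move=> z /unit_ballE; exact: retraction_differentiable.
- by move=> z /inV /VB.
- apply/seteqP; split; first by move=> _ [z Bz <-]; exact: inV.
  by move=> z Vz; exists z; [exact: VB|exact: fixV].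
- exact: fixV.
Qed.

End Retraction.

Theorem theorem3p1 (R : realType) (d : nat) (V : set (Cn R d))
  (subV : V `<=` unit_ball R d)
  (convV : relatively_polynomially_convex (unit_ball R d) V)
  (extV : extension_property (unit_ball R d) V) :
  is_retract (unit_ball R d) V.
Proof.
(* On the empty set the supremum is -oo, which no function attains on the ball, as the latter
   contains 0. *)
have [v Vv] : exists v, V v.
  apply: contrapT => noV; have V0 : V = set0 by rewrite -subset0 => z Vz; apply: noV; exists z.
  have [F [_ _]] := extV (mpoly.mpolyC d 0).
  rewrite V0 /supnorm image_set0 ereal_sup0 => /ereal_sup_ninfty/(_ (cabs (F 0))%:E).
  suff B0 : unit_ball R d 0 by move=> /(_ (ex_intro2 _ _ _ B0 erefl)).
  by rewrite /unit_ball /= big1 ?ltr01// => j _; rewrite mxE normr0 expr0n.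
by apply: (line_closed_is_retract subV Vv) => z w t Vz Vw zw; exact: line_subset.
Qed.
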